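(* Let $X=\mathbb{R}^N$, $g\in\Gamma_0(\mathbb{R}^N)$, $h:\mathbb{R}^N\to\mathbb{R}$ convex and differentiable with $L$-Lipschitz gradient, $L\in]0,+\infty[$, and $f=g+h$. Let $\lambda\in]0,2L^{-1}[$, $x_0\in\mathbb{R}^N$, $x_{n+1}=\operatorname{prox}_{\lambda g}(x_n-\lambda\nabla h(x_n))$ for $n\in\mathbb{N}$, and suppose that $(x_n)$ converges to some $\bar x\in\operatorname{argmin} f$. Assume that: (a) $g$ is mirror-stratifiable (with strata $\{M_i\}$ of $\operatorname{dom}\partial g$, strata $\{M_i^*\}$ of $\operatorname{dom}\partial g^*$, and bijection $J_g$), and define $$C_{\bar x}:=\bigcup\{M\ :\ M \text{ a stratum of }\operatorname{dom}\partial g,\ M_{\bar x}\preceq M\preceq J_g^{-1}(M^*_{-\nabla h(\bar x)})\};$$ (b) $f$ is $p$-Łojasiewicz, with constant $c$, on $C_{\bar x}\cap\mathbb{B}(\bar x,\delta)$ for some $\delta\in]0,+\infty]$ and $p\in[1,+\infty[$. Then there exists $n_0\in\mathbb{N}$ such that the sequence $y_n:=x_{n_0+n}$ satisfies the following. With $r_n:=f(y_n)-\inf f$ and $\kappa:=\lambda(2-\lambda L)[2c^2]^{-1}$, there exist constants $C_p,C_p'>0$ such that: (i) if $p=1$: $y_n=\bar x$ for every $n\ge r_0/\kappa$; (ii) if $p\in]1,2[$: for all $n\in\mathbb{N}$, $r_{n+1}\le(r_n/\kappa)^{\frac{p}{2(p-1)}}$ and $\|y_{n+1}-\bar x\|\le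 C_p r_n^{1/2}$; (iii) if $p=2$: for all $n\in\mathbb{N}$, $r_{n+1}\le\frac1{1+\kappa}r_n$ and $\|y_{n+1}-\bar x\|\le C_2r_0^{1/2}(1+\kappa)^{-n/2}$; (iv) if $p>2$: for all $n\in\mathbb{N}$, $r_n\le(C_p')^{p/(p-2)}n^{-\frac p{p-2}}$ and $\|y_{n+1}-\bar x\|\le C_p(C_p')^{1/(p-2)}n^{-\frac1{p-2}}$. When $0<r_0<+\infty$, the constants can be taken as: $C_p=2pc(2-\lambda L)^{-1}+(2\lambda r_0)^{1/2}(2-\lambda L)^{-1/2}r_0^{-1/p}$ if $p\ge2$; $C_p=2pc\,r_0^{1/p}(2-\lambda L)^{-1}r_0^{-1/2}+(2\lambda)^{1/2}(2-\lambda L)^{-1/2}$ if $p\le2$; and, for $p>2$, $$(C_p')^{-1}=\min\left\{\kappa,\kappa^{\frac{p-2}{2p-2}}\right\}\max_{s\ge1}\min\left\{\frac{p-2}{ps},\ \kappa^{\frac{2-p}{2p-2}}r_0^{\frac{2-p}{p}}\left(1-s^{-\frac{p-2}{2p-2}}\right)\right\}.$$ Moreover, $C_{\bar x}=M_{\bar x}$ holds whenever $0\in\operatorname{ri}\partial f(\bar x)$.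
   Context: $\Gamma_0(\mathbb{R}^N)$ is the set of proper, convex, lower semicontinuous functions $\mathbb{R}^N\to]-\infty,+\infty]$; $\operatorname{ri}$ is the relative interior; $g^*$ is the Fenchel conjugate. $\operatorname{prox}_{\lambda g}(x)=\operatorname{argmin}_{u}\{g(u)+\frac1{2\lambda}\|u-x\|^2\}$. $\mathbb{B}(\bar x,\delta)$ is the open ball. A set $M\subset\mathbb{R}^N$ is stratified by $\{M_i\}_{i=1}^s$ if this family is a finite partition of $M$ such that $M_i\cap\operatorname{cl} M_j\neq\emptyset\Leftrightarrow M_i\subset\operatorname{cl} M_j$; one writes $M_i\preceq M_j$ iff $M_i\subset\operatorname{cl} M_j$, and $\preceq$ is understood to be an order relation on the family of strata. For $x\in M$, $M_x$ is the unique stratum containing $x$ (and $M^*_u$ the stratum of $\operatorname{dom}\partial g^*$ containing $u$). A function $g\in\Gamma_0(\mathbb{R}^N)$ is mirror-stratifiable if: $\operatorname{dom}\partial g$ is stratified by $\{M_i\}_{i=1}^s$ and $\operatorname{dom}\partial g^*$ by $\{M_i^*\}_{i=1}^s$; the map $J_g:M\mapsto\bigcup_{x\in M}\operatorname{ri}\partial g(x)$ is a bijection from $\{M_i\}$ onto $\{M_i^*\}$; and $J_g$ is decreasing: $M_i\preceq M_j\Leftrightarrow J_g(M_j)\preceq J_g(M_i)$. $\operatorname{dom}^*f:=\operatorname{dom} f\setminus\operatorname{argmin} f$; $\|\partial f(x)\|_-:=\operatorname{dist}(0,\partial f(x))$, equal to $+\infty$ if $\partial f(x)=\emptyset$. For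 $p\in[1,+\infty[$, $f$ is $p$-Łojasiewicz on $\Omega$ with constant $c>0$ if $(f(x)-\inf f)^{1-1/p}\le c\,\|\partial f(x)\|_-$ for all $x\in\Omega\cap\operatorname{dom}^*f$. Right-hand sides are allowed to equal $+\infty$ (with $0^{-s}=+\infty$ for $s>0$). *)

(* Defs.v *)
From HB Require Import structures.
From mathcomp Require Import all_boot all_order all_algebra.
From mathcomp Require Import all_classical all_reals all_analysis.

Set Implicit Arguments.
Unset Strict Implicit.
Unset Printing Implicit Defensive.

Import Order.TTheory GRing.Theory Num.Theory.
Import numFieldNormedType.Exports.

Local Open Scope classical_set_scope.
Local Open Scope ring_scope.

(* R^N is the type 'rV[R]_N. Its library norm is the sup norm, so the Euclidean
   one is defined here; the topology (closure, limits, semicontinuity,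
   differentiability) is the library's, which is the Euclidean topology. *)
Section Euclidean.
Context {R : realType} {N : nat}.
Local Notation V := 'rV[R]_N.

Definition dotv (u v : V) : R := \sum_(i < N) u 0 i * v 0 i.

Definition enorm (u : V) : R := Num.sqrt (dotv u u).

Definition eball (a : V) (delta : \bar R) : set V :=
  [set x | ((enorm (x - a))%:E < delta)%E].

(* Equal to +oo when A is empty. *)
Definition dist_set (a : V) (A : set V) : \bar R :=
  ereal_inf [set (enorm (u - a))%:E | u in A].

Definition grad (h : V -> R) (x : V) : V :=
  \row_(i < N) 'D_(delta_mx 0 i) h x.

Definition affine_set (A : set V) : Prop :=
  forall (x y : V) (t : R), A x -> A y -> A (t *: x + (1 - t) *: y).

Definition aff (A : set V) : set V := smallest affine_set A.

Definition ri (A : set V) : set V :=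
  [set x | A x /\
    exists2 e : R, 0 < e & eball x e%:E `&` aff A `<=` A].

End Euclidean.

Section ConvexAnalysis.
Context {R : realType} {N : nat}.
Local Notation V := 'rV[R]_N.
Implicit Types f g : V -> \bar R.
Local Open Scope ereal_scope.

Definition edom f : set V := [set x | f x < +oo].

Definition proper_fun f : Prop := (forall x, f x != -oo) /\ edom f !=set0.

Definition convex_efun f : Prop :=
  forall (x y : V) (t : R), (0 <= t <= 1)%R ->
    f (t *: x + (1 - t) *: y)%R <= t%:E * f x + (1 - t)%:E * f y.

Definition Gamma0 f : Prop :=
  [/\ proper_fun f, convex_efun f & lower_semicontinuous f].

(* Empty at every x with f x = +oo, as soon as f is proper. *)
Definition subdiff f (x : V) : set V :=
  [set u | forall y, f x + (dotv u (y - x))%:E <= f y].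

Definition dom_subdiff f : set V := [set x | subdiff f x !=set0].

Definition conjugate f (u : V) : \bar R :=
  ereal_sup (range (fun x : V => (dotv u x)%:E - f x)).

Definition einf f : \bar R := ereal_inf (range f).

Definition argmin f : set V := [set x | forall y, f x <= f y].

(* The argmin as a set; it is a singleton when g is in Gamma0 and lam > 0. *)
Definition prox (lam : R) g (x : V) : set V :=
  argmin (fun u => g u + ((2 * lam)^-1 * enorm (u - x) ^+ 2)%:E).

Definition lojasiewicz (p c : R) f (Omega : set V) : Prop :=
  forall x, (Omega `&` (edom f `\` argmin f)) x ->
    (f x - einf f) `^ (1 - p^-1) <= c%:E * dist_set 0%R (subdiff f x).

End ConvexAnalysis.

Section Stratification.
Context {R : realType} {N : nat}.
Local Notation V := 'rV[R]_N.

Definition prec_strata (M M' : set V) : Prop := M `<=` closure M'.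

(* A family of strata is given as the set S of its members. The last clause is
   the antisymmetry of prec_strata, which together with reflexivity and
   transitivity (both automatic) makes it an order on the strata. *)
Definition stratified (A : set V) (S : set (set V)) : Prop :=
  [/\ finite_set S,
      partition S id A,
      (forall M M', S M -> S M' ->
         (M `&` closure M' !=set0 <-> M `<=` closure M')) &
      (forall M M', S M -> S M' ->
         prec_strata M M' -> prec_strata M' M -> M = M')].

Definition stratum_of (S : set (set V)) (x : V) : set V := pblock S id x.

Definition Jmap (g : V -> \bar R) (M : set V) : set V :=
  \bigcup_(x in M) ri (subdiff g x).

Definition mirror_stratification (g : V -> \bar R) (S S' : set (set V)) : Prop :=
  [/\ stratified (dom_subdiff g) S,
      stratified (dom_subdiff (conjugate g)) S',
      set_bij S S' (Jmap g) &
      forall M M', S M -> S M' ->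
        (prec_strata M M' <-> prec_strata (Jmap g M') (Jmap g M))].

Definition Jinv (g : V -> \bar R) (S : set (set V)) : set V -> set V :=
  pinv S (Jmap g).

Definition Cset (g : V -> \bar R) (S S' : set (set V)) (xbar ubar : V) : set V :=
  \bigcup_(M in [set M | S M /\ prec_strata (stratum_of S xbar) M /\
                         prec_strata M (Jinv g S (stratum_of S' ubar))]) M.

End Stratification.

Section Constants.
Context {R : realType}.

(* Power of a nonnegative real with the convention 0^(-s) = +oo for s > 0;
   the library's powR has value 0 there. *)
Definition epowR (a s : R) : \bar R :=
  if (a == 0) && (s < 0) then +oo%E else (a `^ s)%:E.

Definition kappa (lam L c : R) : R := lam * (2 - lam * L) * (2 * c ^+ 2)^-1.

Definition Cp_ge2 (p c lam L r0 : R) : R :=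
  2 * p * c * (2 - lam * L)^-1
  + (2 * lam * r0) `^ 2^-1 * (2 - lam * L) `^ (- 2^-1) * r0 `^ (- p^-1).

Definition Cp_le2 (p c lam L r0 : R) : R :=
  2 * p * c * r0 `^ (p^-1) * (2 - lam * L)^-1 * r0 `^ (- 2^-1)
  + (2 * lam) `^ 2^-1 * (2 - lam * L) `^ (- 2^-1).

Definition is_max (A : set R) (m : R) : Prop := A m /\ ubound A m.

Definition Cp'_objective (p k r0 s : R) : R :=
  Num.min ((p - 2) / (p * s))
    (k `^ ((2 - p) / (2 * p - 2)) * r0 `^ ((2 - p) / p)
     * (1 - s `^ (- ((p - 2) / (2 * p - 2))))).

Definition Cp'_spec (p k r0 C : R) : Prop :=
  exists2 m, is_max [set Cp'_objective p k r0 s | s in [set s | 1 <= s]] m &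
    C^-1 = Num.min k (k `^ ((p - 2) / (2 * p - 2))) * m.

End Constants.

(* Main.v *)
Require Import Defs.
From HB Require Import structures.
From mathcomp Require Import all_boot all_order all_algebra.
From mathcomp Require Import all_classical all_reals all_analysis.
From mathcomp Require Import finmap ring lra.

Import Order.TTheory GRing.Theory Num.Theory.
Import numFieldNormedType.Exports.

Set Implicit Arguments.
Unset Strict Implicit.
Unset Printing Implicit Defensive.

Local Open Scope classical_set_scope.
Local Open Scope ring_scope.

(** The corollary combines an identification property with the usual analysis of
    descent methods under a Lojasiewicz inequality.

    Identification (near_Cset). The proximal step provides a subgradient u_n of g
    at x_n, and u_n tends to ubar := - grad h xbar, because x_n tends to xbar and
    grad h is continuous. As there are finitely many strata, the stratum of a
    point close to xbar follows that of xbar, and likewise for the strata of the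
    domain of the subdifferential of the conjugate around ubar. Moreover u_n is a
    limit of points in the relative interior of the subdifferential of g at x_n
    (sub_closure_ri), so that the stratum of u_n precedes the mirror image of the
    stratum of x_n (prec_strata_Jmap). Reversing the order with the mirror map
    places the stratum of x_n between the two strata that define the set on which
    f is assumed to be Lojasiewicz: x_n belongs to this set for large n. When 0 is
    in the relative interior of the subdifferential of f at xbar, ubar is in that
    of g, and both strata are the same (Cset_ri).

    Rates. Let r_n be the value gap and a_n the length of the n-th step. The
    descent lemma gives s a_n^2 <= r_n - r_(n+1) with s = (2 - lam L) / (2 lam)
    (fb_descent). Since a gradient step of h is nonexpansive, by the cocoercivity
    of the gradient, the subdifferential of f at x_(n+1) has an element of norm at
    most a_n / lam (fb_dist_subdiff). Inserted in the Lojasiewicz inequality,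
    these bounds give
      r_(n+1) + kappa r_(n+1)^(2 - 2/p) <= r_n    (value_recursion),
    from which the rates of r_n follow for each range of p; for p > 2 the quantity
    r_n^(-(p-2)/p) grows by a fixed amount at each step (inverse_power_step). They
    also show that the energy a_n + C p c r_(n+1)^(1/p) drops by at least a_(n+1)
    (energy_drop), so the distance from x_(n+1) to the limit is at most the energy,
    which is bounded by powers of r_n (energy_le). *)

(** * Euclidean geometry of row vectors *)

Section EuclideanGeometry.
Context {R : realType} {N : nat}.
Implicit Types (u v w : 'rV[R]_N) (a : R).

Lemma dotvC u v : dotv u v = dotv v u.
Proof. by apply: eq_bigr => i _; rewrite mulrC. Qed.

Lemma dotvDl u v w : dotv (u + v) w = dotv u w + dotv v w.
Proof. by rewrite -big_split; apply: eq_bigr => i _; rewrite mxE mulrDl. Qed.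

Lemma dotvZl a u v : dotv (a *: u) v = a * dotv u v.
Proof. by rewrite mulr_sumr; apply: eq_bigr => i _; rewrite mxE mulrA. Qed.

Lemma dotvNl u v : dotv (- u) v = - dotv u v.
Proof. by rewrite -scaleN1r dotvZl mulN1r. Qed.

Lemma dotvDr u v w : dotv u (v + w) = dotv u v + dotv u w.
Proof. by rewrite dotvC dotvDl !(dotvC u). Qed.

Lemma dotvZr a u v : dotv u (a *: v) = a * dotv u v.
Proof. by rewrite dotvC dotvZl (dotvC u). Qed.

Lemma dotvNr u v : dotv u (- v) = - dotv u v.
Proof. by rewrite dotvC dotvNl (dotvC u). Qed.

Definition dotvE := (dotvDl, dotvDr, dotvNl, dotvNr, dotvZl, dotvZr).

Lemma dotv0l v : dotv 0 v = 0.
Proof. by rewrite -(scale0r 0) dotvZl mul0r. Qed.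

Lemma dotvv_ge0 u : 0 <= dotv u u.
Proof. by apply: sumr_ge0 => i _; rewrite -expr2 sqr_ge0. Qed.

Lemma enorm_ge0 u : 0 <= enorm u.
Proof. exact: sqrtr_ge0. Qed.

Lemma enorm_sqr u : enorm u ^+ 2 = dotv u u.
Proof. by rewrite sqr_sqrtr ?dotvv_ge0. Qed.

Lemma enormZ a u : enorm (a *: u) = `|a| * enorm u.
Proof.
by rewrite /enorm dotvZl dotvZr mulrA -expr2 sqrtrM ?sqr_ge0 // sqrtr_sqr.
Qed.

Lemma enorm0 : enorm (0 : 'rV[R]_N) = 0.
Proof. by rewrite /enorm dotv0l sqrtr0. Qed.

Lemma enormN u : enorm (- u) = enorm u.
Proof. by rewrite -scaleN1r enormZ normrN1 mul1r. Qed.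

Lemma enormBC u v : enorm (u - v) = enorm (v - u).
Proof. by rewrite -enormN opprB. Qed.

Lemma enorm_eq0 u : enorm u = 0 -> u = 0.
Proof.
move=> u0; have := enorm_sqr u; rewrite u0 expr0n /= => /esym/eqP.
rewrite psumr_eq0 => [/allP u00|i _]; last by rewrite -expr2 sqr_ge0.
apply/rowP => i; rewrite mxE; have := u00 i (mem_index_enum _).
by rewrite -expr2 sqrf_eq0 => /eqP.
Qed.

(** Cauchy-Schwarz: the quadratic polynomial t |-> |u - t v|^2 is nonnegative
    at its vertex. *)
Lemma dotv_le u v : dotv u v <= enorm u * enorm v.
Proof.
have [v0|v0] := eqVneq (enorm v) 0.
  by rewrite (enorm_eq0 v0) enorm0 mulr0 dotvC dotv0l.
have vp : 0 < enorm v by rewrite lt_neqAle eq_sym v0 enorm_ge0.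
apply: le_trans (ler_norm _) _.
rewrite -ler_sqr ?nnegrE ?mulr_ge0 ?enorm_ge0 // real_normK ?num_real //.
rewrite exprMn !enorm_sqr.
have vv : 0 < dotv v v by rewrite -enorm_sqr exprn_gt0.
have := dotvv_ge0 (dotv v v *: u - dotv u v *: v).
rewrite !dotvE (dotvC v u).
set s := dotv u u; set t := dotv v v; set d := dotv u v => H.
rewrite -subr_ge0 -(pmulr_rge0 _ vv) -/t.
by apply: le_trans H _; rewrite le_eqVlt; apply/orP; left; apply/eqP; ring.
Qed.

Lemma enormD u v : enorm (u + v) <= enorm u + enorm v.
Proof.
rewrite -ler_sqr ?nnegrE ?addr_ge0 ?enorm_ge0 // sqrrD !enorm_sqr !dotvE.
by rewrite (dotvC v u); have := dotv_le u v; lra.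
Qed.

Lemma le_coord_enorm u i : `|u 0 i| <= enorm u.
Proof.
rewrite -ler_sqr ?nnegrE ?enorm_ge0 // enorm_sqr real_normK ?num_real //.
rewrite /dotv (bigD1 i) //= -expr2 lerDl.
by apply: sumr_ge0 => j _; rewrite -expr2 sqr_ge0.
Qed.

Lemma enorm_le_sum u : enorm u <= \sum_(i < N) `|u 0 i|.
Proof.
have sum_ge0 (s : seq 'I_N) : 0 <= \sum_(i <- s) `|u 0 i|.
  by apply: sumr_ge0.
rewrite -ler_sqr ?nnegrE ?enorm_ge0 // enorm_sqr /dotv.
elim: (index_enum _) => [|i s IH]; first by rewrite !big_nil expr0n.
rewrite !big_cons sqrrD -addrA lerD //.
  by rewrite -expr2 real_normK ?num_real.
by apply: le_trans IH _; rewrite lerDr mulrn_wge0 ?mulr_ge0.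
Qed.

Lemma le_norm_enorm u : `|u| <= enorm u.
Proof.
rewrite /Num.norm /= /mx_norm.
have -> : enorm u = (NngNum (enorm_ge0 u))%:num by [].
rewrite [_ <= _%:num]num_le; apply/bigmax_leP; split => [|i _].
  by rewrite -num_le /= enorm_ge0.
by rewrite -num_le /= ord1 le_coord_enorm.
Qed.

Lemma enorm_le_norm u : enorm u <= N%:R * `|u|.
Proof.
apply: le_trans (enorm_le_sum u) _.
rewrite mulr_natl -[X in _ *+ X](card_ord N) -sumr_const.
apply: ler_sum => i _; rewrite /Num.norm /= /mx_norm.
have le_num (a b : {nonneg R}) : (a <= b)%O -> a%:num <= b%:num by [].
by apply: (le_num (`|u 0 i|%:nng)); exact: (bigmax_sup (0, i)).
Qed.

End EuclideanGeometry.

Section EuclideanTopology.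
Context {R : realType} {N : nat}.
Implicit Types (u v : 'rV[R]_N) (x : nat -> 'rV[R]_N).

Lemma cvg_near_enorm x u (e : R) : x @ \oo --> u -> 0 < e ->
  \forall n \near \oo, enorm (x n - u) < e.
Proof.
move=> /cvgrPdist_lt xu e0; have N0 : 0 < N.+1%:R :> R by rewrite ltr0n.
have := xu (e / N.+1%:R) (divr_gt0 e0 N0); apply: filterS => n.
rewrite distrC ltr_pdivlMr // mulrC; apply: le_lt_trans.
apply: le_trans (enorm_le_norm _) _.
by rewrite ler_wpM2r // ler_nat.
Qed.

Lemma near_enorm_cvg x u :
  (forall e : R, 0 < e -> \forall n \near \oo, enorm (x n - u) < e) ->
  x @ \oo --> u.
Proof.
move=> xu; apply/cvgrPdist_lt => e e0; apply: filterS (xu e e0) => n.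
by rewrite distrC; apply: le_lt_trans; exact: le_norm_enorm.
Qed.

Lemma closure_cvg (A : set 'rV[R]_N) x u :
  x @ \oo --> u -> (forall n, A (x n)) -> closure A u.
Proof.
move=> xu Ax B /xu [n _ /(_ n (leqnn n)) Bxn].
by exists (x n); split.
Qed.

End EuclideanTopology.

(** * Convex functions with Lipschitz gradient *)

Section SmoothConvex.
Context {R : realType} {N : nat}.
Implicit Types (x y z v : 'rV[R]_N).
Variable h : 'rV[R]_N -> R.
Hypothesis hdiff : forall z, differentiable h z.

Lemma derive_dotv_grad x v : 'D_v h x = dotv (grad h x) v.
Proof.
rewrite deriveE // {1}(row_sum_delta v) linear_sum; apply: eq_bigr => i _.
by rewrite linearZ /= mxE deriveE // mulrC.
Qed.

Lemma is_derive_line x v (t : R) :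
  is_derive t 1 (fun s : R => h (x + s *: v)) (dotv (grad h (x + t *: v)) v).
Proof.
have quotE : (fun s : R => s^-1 *: (h (x + (s *: 1 + t) *: v) - h (x + t *: v)))
    = (fun s : R => s^-1 *: (h (s *: v + (x + t *: v)) - h (x + t *: v))).
  by apply/funext => s; rewrite scalerDl /GRing.scale /= mulr1 addrCA.
have dv : derivable h (x + t *: v) v by exact: diff_derivable.
split; first by rewrite /derivable /= quotE.
by rewrite /derive /= quotE -/(derive _ _ _) derive_dotv_grad.
Qed.

Section Convex.
Hypothesis hconv : convex_function [set: convex_lmodType 'rV[R]_N] h.

Lemma convex_function_le x y (t : R) : 0 <= t <= 1 ->
  h (t *: y + (1 - t) *: x) <= t * h y + (1 - t) * h x.
Proof.
move=> /andP[t0 t1].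
by have := hconv (Itv01 t0 t1) (in_setT y) (in_setT x).
Qed.

(** The difference quotients of h from x towards y stay below h y - h x. *)
Lemma convex_grad_le x y : h x + dotv (grad h x) (y - x) <= h y.
Proof.
rewrite -lerBrDl -derive_dotv_grad.
have dh : derivable h x (y - x) by exact: diff_derivable.
have /cvg_dnbhs_at_right quot_cvg := dh.
apply: (cvgr_to_le quot_cvg).
near=> t.
have t0 : 0 < t by near: t; exact: nbhs_right_gt.
have t1 : t <= 1 by near: t; exact: nbhs_right_le.
rewrite /GRing.scale /= mulrC ler_pdivrMr //.
have -> : t *: (y - x) + x = t *: y + (1 - t) *: x.
  by rewrite scalerBr scalerBl scale1r -addrA (addrC x) addrCA addrA addrAC.
have /convex_function_le H : 0 <= t <= 1 by rewrite ltW.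
by have := H x y; lra.
Unshelve. all: by end_near. Qed.

End Convex.

Section Lipschitz.
Variable L : R.
Hypothesis L0 : 0 < L.
Hypothesis hlip : forall z w, enorm (grad h z - grad h w) <= L * enorm (z - w).

(** The mean value theorem applied to the difference between h and its
    quadratic majorant on the segment from x to x + v. *)
Lemma descent_lemma x v :
  h (x + v) <= h x + dotv (grad h x) v + L / 2 * dotv v v.
Proof.
pose psi (s : R) := h (x + s *: v) - s * dotv (grad h x) v
  - s ^+ 2 * (L / 2 * dotv v v).
pose dpsi (s : R) := dotv (grad h (x + s *: v)) v - dotv (grad h x) v
  - 2 * s * (L / 2 * dotv v v).
have dpsiP (s : R) : is_derive s 1 psi (dpsi s).
  have hl := is_derive_line x v s.
  rewrite /psi; apply: is_derive_eq.
  rewrite /dpsi /GRing.scale /=; ring.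
have [c /[!in_itv]/= /andP[c0 c1]] : exists2 c, c \in `]0, 1[ &
    psi 1 - psi 0 = dpsi c * (1 - 0).
  apply: MVT => // ; apply: continuous_subspaceT => s.
  by apply: differentiable_continuous; apply/derivable1_diffP.
rewrite subr0 mulr1 /psi scale1r scale0r addr0.
have : dpsi c <= 0.
  rewrite /dpsi -dotvNl -dotvDl.
  have := dotv_le (grad h (x + c *: v) - grad h x) v.
  have := hlip (x + c *: v) x; 
    rewrite [X in L * enorm X]addrC addKr enormZ gtr0_norm //.
  have := enorm_ge0 v; rewrite -enorm_sqr; nra.
lra.
Qed.

Hypothesis hconv : convex_function [set: convex_lmodType 'rV[R]_N] h.

(** The convex function h - <grad h x, .> is minimal at x; its value at x is
    thus below the value reached from y by a gradient step of length 1 / L. *)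
Lemma convex_grad_le_strong x y :
  h x + dotv (grad h x) (y - x)
    + (2 * L)^-1 * dotv (grad h y - grad h x) (grad h y - grad h x) <= h y.
Proof.
set d := grad h y - grad h x.
have := convex_grad_le hconv x (y - L^-1 *: d).
have := descent_lemma y (- (L^-1 *: d)).
have -> : grad h y = d + grad h x by rewrite /d subrK.
rewrite !dotvE.
have -> : (2 * L)^-1 = L^-1 / 2 by rewrite invfM mulrC.
have Ld : L / 2 * - (L^-1 * - (L^-1 * dotv d d)) = L^-1 / 2 * dotv d d.
  by field; rewrite gt_eqF.
rewrite ?dotvE in Ld *; lra.
Qed.

(** Baillon-Haddad: the gradient is cocoercive. *)
Lemma grad_cocoercive x y :
  dotv (grad h x - grad h y) (grad h x - grad h y)
    <= L * dotv (grad h x - grad h y) (x - y).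
Proof.
have := convex_grad_le_strong x y; have := convex_grad_le_strong y x.
have -> : dotv (grad h y - grad h x) (grad h y - grad h x)
    = dotv (grad h x - grad h y) (grad h x - grad h y).
  by rewrite -opprB dotvNl dotvNr opprK.
set d := dotv (_ - _) (_ - _).
rewrite -ler_pdivrMl // !dotvE.
have -> : (2 * L)^-1 = L^-1 / 2 by rewrite invfM mulrC.
lra.
Qed.

Lemma gradient_step_nonexpansive (lam : R) x y : 0 <= lam <= 2 / L ->
  enorm ((x - lam *: grad h x) - (y - lam *: grad h y)) <= enorm (x - y).
Proof.
move=> /andP[lam0]; rewrite ler_pdivlMr // => lamL.
rewrite -ler_sqr ?nnegrE ?enorm_ge0 // !enorm_sqr.
have -> : (x - lam *: grad h x) - (y - lam *: grad h y)
    = (x - y) - lam *: (grad h x - grad h y).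
  by rewrite scalerBr !opprB addrACA [RHS]addrACA; congr (_ + _); rewrite addrC.
have := dotvv_ge0 (grad h x - grad h y).
have := grad_cocoercive x y.
move: (grad h x - grad h y) (x - y) => d u.
rewrite !dotvDl !dotvDr !dotvNl !dotvNr !dotvZl !dotvZr (dotvC u d).
move=> cocoer d0; have lamd : lam * dotv d d <= 2 * dotv d u.
  by rewrite -(ler_pM2l L0); nra.
by have := ler_wpM2l lam0 lamd; lra.
Qed.

End Lipschitz.
End SmoothConvex.

(** * Subdifferentials *)

Lemma ler_of_vanishing_slack (R : realFieldType) (a b c : R) :
  (forall t, 0 < t <= 1 -> a <= b + t * c) -> a <= b.
Proof.
move=> H; apply/ler_addgt0Pr => e e0.
have c1 : 0 < `|c| + 1 by rewrite ltr_wpDl.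
set t := Num.min 1 (e / (`|c| + 1)).
have t01 : 0 < t <= 1 by rewrite lt_min ltr01 divr_gt0 //= ge_min lexx.
apply: le_trans (H t t01) _; rewrite lerD2l.
have [t0 _] := andP t01.
have : t * c <= t * (`|c| + 1).
  by rewrite ler_pM2l // (le_trans (ler_norm c)) // lerDl.
move=> /le_trans; apply.
by rewrite -ler_pdivlMr // ge_min lexx orbT.
Qed.

Section Subdifferential.
Context {R : realType} {N : nat}.
Implicit Types (g f : 'rV[R]_N -> \bar R) (h : 'rV[R]_N -> R).
Implicit Types (x y z u v w : 'rV[R]_N) (lam L : R).

Lemma subdiffP g x u : proper_fun g ->
  subdiff g x u <-> g x \is a fin_num /\
    forall y, g y \is a fin_num -> fine (g x) + dotv u (y - x) <= fine (g y).
Proof.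
move=> [gNy [z zdom]]; split=> [ux|[gxfin ux] y].
  have gxfin : g x \is a fin_num.
    rewrite fin_numE gNy /=; apply/eqP => gx; have := ux z.
    by rewrite gx addye // leye_eq => /eqP gz; move: zdom; rewrite /edom /= gz ltxx.
  split=> // y gy; have := ux y.
  by rewrite -(fineK gxfin) -(fineK gy) -EFinD lee_fin.
have [gy|] := boolP (g y \is a fin_num).
  by rewrite -(fineK gxfin) -(fineK gy) -EFinD lee_fin ux.
by rewrite fin_numE gNy negbK => /eqP ->; rewrite leey.
Qed.

(** Fermat's rule. *)
Lemma argmin_subdiff f x : argmin f x <-> subdiff f x 0.
Proof.
by split=> fx y; have := fx y; rewrite dotv0l adde0.
Qed.

(** Equality holds in the Fenchel-Young inequality at a subgradient. *)
Lemma subdiff_conjugate g x u : proper_fun g ->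
  subdiff g x u -> subdiff (conjugate g) u x.
Proof.
move=> gP ux; have [gxfin uxr] := (subdiffP x u gP).1 ux.
have conju : conjugate g u = (dotv u x - fine (g x))%:E.
  apply/eqP; rewrite eq_le; apply/andP; split; last first.
    by apply: ereal_sup_ubound; exists x => //; rewrite EFinB fineK.
  apply: ge_ereal_sup => _ [y _ <-].
  have [gy|] := boolP (g y \is a fin_num).
    rewrite -(fineK gy) -EFinB lee_fin; have := uxr y gy.
    by rewrite !dotvE; lra.
  by rewrite fin_numE gP.1 negbK => /eqP ->; rewrite leNye.
move=> v; rewrite conju -EFinD.
apply: le_trans (ereal_sup_ubound _); last by exists x; first by [].
rewrite -(fineK gxfin) -EFinB lee_fin !dotvE (dotvC x v) (dotvC x u).
by rewrite addrAC addrCA subrr addr0 addrC.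
Qed.

(** A quadratic slack may be dropped from a subgradient inequality: it is of
    second order at x, while convexity makes the inequality scale linearly
    along segments issued from x. *)
Lemma subdiff_quadratic_slack g x w (K : R) :
  proper_fun g -> convex_efun g -> g x \is a fin_num ->
  (forall y, g y \is a fin_num ->
    fine (g x) + dotv w (y - x) <= fine (g y) + K * dotv (y - x) (y - x)) ->
  subdiff g x w.
Proof.
move=> gP gC gx slack; apply/subdiffP => //; split=> // y gy.
apply: (@ler_of_vanishing_slack _ _ _ (K * dotv (y - x) (y - x))) => t t01.
have [t0 t1] := andP t01.
have t01' : 0 <= t <= 1 by rewrite t1 ltW.
have := gC y x t t01'; set z := _ + _ => gz_le.
have zx : z - x = t *: (y - x).
  by rewrite /z scalerBl scale1r scalerBr addrA addrAC addrK.
have gz : g z \is a fin_num.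
  rewrite fin_numE gP.1 /=; apply/eqP => gzy; move: gz_le.
  by rewrite gzy -(fineK gx) -(fineK gy) -!EFinM -EFinD leye_eq.
have := slack z gz.
move: gz_le; rewrite -(fineK gx) -(fineK gy) -(fineK gz) -!EFinM -EFinD lee_fin.
rewrite zx !dotvZr dotvZl => H1 H2.
by rewrite -(ler_pM2l t0); lra.
Qed.

(** Once the squares are expanded, the minimality of x is the subgradient
    inequality up to a quadratic slack. *)
Lemma prox_subdiff g lam z x : proper_fun g -> convex_efun g -> 0 < lam ->
  prox lam g z x -> subdiff g x (lam^-1 *: (z - x)).
Proof.
move=> gP gC lam0 xP.
have gx : g x \is a fin_num.
  rewrite fin_numE gP.1 /=; apply/eqP => gxy; have [_ [y ydom]] := gP.
  have := xP y; rewrite gxy addye // leye_eq.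
  by have /fineK <- : g y \is a fin_num by rewrite fin_numElt ydom andbT ltNye gP.1.
apply: (@subdiff_quadratic_slack _ _ _ (2 * lam)^-1) => // y gy.
have := xP y; rewrite -(fineK gx) -(fineK gy) -!EFinD lee_fin !enorm_sqr /=.
have -> : y - z = (y - x) + (x - z) by rewrite addrA subrK.
have -> : z - x = - (x - z) by rewrite opprB.
move: (x - z) (y - x) => d v.
by rewrite dotvDl !dotvDr dotvZl dotvNl (dotvC d v) invfM; lra.
Qed.

Section SmoothSum.
Variables (g : 'rV[R]_N -> \bar R) (h : 'rV[R]_N -> R) (L : R).
Hypotheses (gP : proper_fun g) (gC : convex_efun g).
Hypotheses (hdiff : forall z, differentiable h z)
  (hconv : convex_function [set: convex_lmodType 'rV[R]_N] h)
  (hlip : forall z w, enorm (grad h z - grad h w) <= L * enorm (z - w)).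
Let f z := (g z + (h z)%:E)%E.

Lemma fin_num_sum x : (f x \is a fin_num) = (g x \is a fin_num).
Proof. by rewrite fin_numD andbT. Qed.

Lemma proper_sum : proper_fun f.
Proof.
case: gP => gNy [z zdom]; split=> [x|]; last first.
  by exists z; rewrite /edom /= lte_add_pinfty ?ltry.
by have := gNy x; rewrite /f; case: (g x).
Qed.

Lemma fine_sum x : g x \is a fin_num -> fine (f x) = fine (g x) + h x.
Proof. by move=> gx; rewrite fineD. Qed.

Lemma subdiff_sum x u : subdiff g x u -> subdiff f x (u + grad h x).
Proof.
move=> /(subdiffP x u gP)[gx ux]; apply/subdiffP; first exact: proper_sum.
rewrite fin_num_sum; split=> // y; rewrite fin_num_sum => gy.
rewrite !fine_sum // dotvDl; have := ux y gy.
by have := convex_grad_le hdiff hconv x y; lra.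
Qed.

(** The descent lemma bounds h by its linearization at x up to a quadratic
    slack. *)
Lemma subdiff_sum_inv x w : subdiff f x w -> subdiff g x (w - grad h x).
Proof.
move=> /(subdiffP x w proper_sum)[]; rewrite fin_num_sum => gx wx.
apply: (@subdiff_quadratic_slack _ _ _ (L / 2)) => // y gy.
have := wx y; rewrite fin_num_sum !fine_sum // => /(_ gy).
have := descent_lemma hdiff hlip x (y - x).
have -> : x + (y - x) = y by rewrite addrC subrK.
by rewrite (dotvDl w) dotvNl; lra.
Qed.

End SmoothSum.
End Subdifferential.

(** * Relative interiors of convex sets *)

Section RelativeInterior.
Context {R : realType} {N : nat}.
Implicit Types (A B : set 'rV[R]_N) (a u v w z : 'rV[R]_N).

Definition convex_combination_closed A : Prop :=
  forall u v (t : R), 0 <= t <= 1 -> A u -> A v -> A (t *: u + (1 - t) *: v).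

Lemma subdiff_convex (g : 'rV[R]_N -> \bar R) x : proper_fun g ->
  convex_combination_closed (subdiff g x).
Proof.
move=> gP u v t /andP[t0 t1] /(subdiffP x _ gP)[gx ux] /(subdiffP x _ gP)[_ vx].
apply/(subdiffP x _ gP); split=> // y gy; rewrite !dotvE.
have := ux y gy; have := vx y gy.
rewrite !dotvE; move: (dotv u y) (dotv u x) (dotv v y) (dotv v x) => a b c d.
move: (fine _) (fine _) => p q H1 H2.
have t1' : 0 <= 1 - t by rewrite subr_ge0.
have := ler_wpM2l t0 H2; have := ler_wpM2l t1' H1; lra.
Qed.

Lemma sub_aff A : A `<=` aff A.
Proof. exact: sub_smallest. Qed.

Lemma affine_aff A : affine_set (aff A).
Proof.
move=> x y t Ax Ay B [Baff AB].
exact: Baff (Ax _ (conj Baff AB)) (Ay _ (conj Baff AB)).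
Qed.

Lemma ri_translate A B a : (forall u, A u <-> B (u - a)) ->
  forall u, ri A u -> ri B (u - a).
Proof.
move=> AB u [Au [e e0 eA]]; split; first exact/AB.
exists e => // z [zball zaff].
have -> : z = (z + a) - a by rewrite addrK.
apply/AB; apply: eA; split.
  by move: zball; rewrite /eball /= opprB addrA.
suff : [set y | aff A (y + a)] z by [].
apply: zaff; split=> [x y t /= Ax Ay|y By /=].
  have -> : t *: x + (1 - t) *: y + a = t *: (x + a) + (1 - t) *: (y + a).
    rewrite !scalerDr addrACA; congr (_ + _).
    by rewrite -scalerDl addrC subrK scale1r.
  exact: affine_aff.
by apply: sub_aff; apply/AB; rewrite addrK.
Qed.

Lemma convex_combination_rows A u k (V : 'M[R]_(k, N)) (c : 'rV[R]_k) :
  convex_combination_closed A -> A u -> (forall i, A (u + row i V)) ->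
  (forall i, 0 <= c 0 i) -> \sum_i c 0 i <= 1 -> A (u + c *m V).
Proof.
move=> Aconv Au; elim: k V c => [|k IH] V c AV c0 csum.
  by rewrite [c]thinmx0 mul0mx addr0.
pose V' := \matrix_i row (lift ord0 i) V.
have AV' i : A (u + row i V') by rewrite rowK.
rewrite big_ord_recl in csum.
have c1_ge0 : 0 <= 1 - c 0 ord0.
  have : 0 <= \sum_i c 0 (lift ord0 i) by apply: sumr_ge0.
  by lra.
have cV : c *m V = c 0 ord0 *: row ord0 V
    + \sum_i c 0 (lift ord0 i) *: row (lift ord0 i) V.
  by rewrite mulmx_sum_row big_ord_recl.
have [c1|c1] := eqVneq (1 - c 0 ord0) 0.
  have c'0 i : c 0 (lift ord0 i) = 0.
    apply/eqP; rewrite eq_le c0 andbT.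
    apply: le_trans (_ : \sum_i c 0 (lift ord0 i) <= 0); last by lra.
    by rewrite (bigD1 i) //= lerDl sumr_ge0.
  rewrite cV big1 => [|i _]; last by rewrite c'0 scale0r.
  by rewrite addr0 -(subr0_eq c1) scale1r.
pose c' : 'rV[R]_k := \row_i ((1 - c 0 ord0)^-1 * c 0 (lift ord0 i)).
have c1p : 0 < 1 - c 0 ord0 by rewrite lt_neqAle eq_sym c1.
have Ac' : A (u + c' *m V').
  apply: IH => // [i|]; first by rewrite mxE mulr_ge0 ?invr_ge0.
  under eq_bigr do rewrite mxE.
  by rewrite -mulr_sumr ler_pdivrMl // mulr1; lra.
have -> : u + c *m V
    = c 0 ord0 *: (u + row ord0 V) + (1 - c 0 ord0) *: (u + c' *m V').
  have c_sum1 : c 0 ord0 + (1 - c 0 ord0) = 1 by rewrite addrC subrK.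
  rewrite !scalerDr addrACA -scalerDl c_sum1 scale1r cV; congr (_ + (_ + _)).
  rewrite mulmx_sum_row scaler_sumr; apply: eq_bigr => i _.
  by rewrite mxE rowK scalerA mulVKf.
by apply: Aconv; rewrite ?c0 //=; lra.
Qed.

(** Any linearly independent family of directions from u into A of maximal
    cardinality will do: a point outside of its span would extend it. *)
Lemma exists_direction_basis A u : exists k (V : 'M[R]_(k, N)),
  [/\ row_free V, forall i, A (u + row i V) &
      forall w, A w -> (w - u <= V)%MS].
Proof.
pose P k := `[< exists V : 'M[R]_(k, N),
  row_free V /\ forall i, A (u + row i V) >].
have P0 : exists k, P k.
  exists 0; apply/asboolP; exists 0; split; last by case.
  by rewrite /row_free mxrank0.
have Pb k : P k -> (k <= N)%N.
  by move=> /asboolP[V [/eqP Vfree _]]; rewrite -Vfree rank_leq_col.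
case: (ex_maxnP P0 Pb) => k /asboolP[V [Vfree AV]] kmax.
exists k, V; split=> // w Aw; apply: contrapT => /negP wV.
have /kmax : P k.+1; last by rewrite ltnn.
have A_rows (i : 'I_(1 + k)) : A (u + row i (col_mx (w - u) V)).
  case: (split_ordP i) => j ->; last by rewrite rowKd.
  by rewrite rowKu row_id addrC subrK.
apply/asboolP; exists (col_mx (w - u) V); split=> [|i].
  rewrite /row_free eqn_leq rank_leq_row /=.
  have : (V < col_mx (w - u) V)%MS.
    rewrite ltmxE -!addsmxE addsmxSr /=; apply: contra wV; apply: submx_trans.
    exact: addsmxSl.
  by move=> /rank_ltmx; rewrite (eqP Vfree).
exact: A_rows.
Qed.

Lemma enorm_mulmx_le k (P : 'M[R]_(N, k)) : exists2 C : R, 0 < C &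
  forall z i, `|(z *m P) 0 i| <= C * enorm z.
Proof.
exists (1 + \sum_j \sum_i `|P j i|).
  by rewrite ltr_pwDl // sumr_ge0 // => j _; rewrite sumr_ge0.
move=> z i; rewrite mxE; apply: le_trans (ler_norm_sum _ _ _) _.
apply: le_trans (_ : \sum_j `|P j i| * enorm z <= _).
  by apply: ler_sum => j _; rewrite normrM mulrC ler_wpM2l // le_coord_enorm.
rewrite -mulr_suml ler_wpM2r ?enorm_ge0 //.
apply: le_trans (_ : \sum_j \sum_i `|P j i| <= _); last by rewrite lerDr.
by apply: ler_sum => j _; rewrite (bigD1 i) //= lerDl sumr_ge0.
Qed.

(** With v_1, ..., v_k a maximal independent family of directions from u into
    the convex set A, the point u + s (v_1 + ... + v_k) with 0 < s <= 1 / (k+1)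
    is relatively interior: nearby points of the affine hull have coordinates
    that are still nonnegative and of sum at most 1. *)
Lemma sub_closure_ri A : convex_combination_closed A -> A `<=` closure (ri A).
Proof.
move=> Aconv u Au.
have [k [V [Vfree AV Vspan]]] := exists_direction_basis A u.
(* The affine space of points u + span V contains A, hence its affine hull. *)
have affA : aff A `<=` [set w | (w - u <= V)%MS].
  apply: smallest_sub => // x y t /= xV yV.
  have -> : t *: x + (1 - t) *: y - u = t *: (x - u) + (1 - t) *: (y - u).
    rewrite !scalerBr addrACA -opprD -scalerDl.
    by congr (_ - _); rewrite addrC subrK scale1r.
  by apply: addmx_sub; apply: scalemx_sub.
have [C C0 HC] := enorm_mulmx_le (pinvmx V).
pose b : 'rV[R]_k := const_mx 1.
pose step n : R := (k.+1%:R * n.+1%:R)^-1.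
have step0 n : 0 < step n by rewrite invr_gt0 mulr_gt0 ?ltr0n.
have stepk n : k.+1%:R * step n <= 1.
  rewrite /step invfM mulrA mulfV ?pnatr_eq0 // mul1r.
  by rewrite invf_le1 ?ltr0n // ler1n.
have coord (c : 'rV[R]_k) : 
    (forall i, 0 <= c 0 i) -> \sum_i c 0 i <= 1 -> A (u + c *m V).
  exact: convex_combination_rows.
apply: (@closure_cvg _ _ _ (fun n => u + (step n *: b) *m V)) => [|n]; last first.
  have A1 : A (u + (step n *: b) *m V).
    apply: coord => [i|]; first by rewrite !mxE mulr1 ltW.
    under eq_bigr do rewrite !mxE mulr1.
    rewrite sumr_const card_ord -mulr_natl (le_trans _ (stepk n)) //.
    by rewrite ler_wpM2r ?ler_nat // ltW.
  split=> //.
  have e0 : 0 < step n / k.+1%:R / C by rewrite !divr_gt0 ?ltr0n.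
  exists (step n / k.+1%:R / C) => // z [zball /affA /= zV].
  pose d := (z - (u + (step n *: b) *m V)) *m pinvmx V.
  have dle i : `|d 0 i| <= step n / k.+1%:R.
    apply: le_trans (HC _ _) _; rewrite mulrC -ler_pdivlMr //.
    by apply: ltW; move: zball; rewrite /eball /= lte_fin.
  have dE : (z - u) *m pinvmx V = step n *: b + d.
    by rewrite /d opprD addrA [in RHS]mulmxBl mulmxKp // [RHS]addrC subrK.
  have -> : z = u + (step n *: b + d) *m V.
    by rewrite -dE mulmxKpV // addrC subrK.
  clearbody d.
  apply: coord => [i|].
    have := dle i; rewrite !mxE mulr1 ler_norml => /andP[+ _].
    have : step n / k.+1%:R <= step n.
      by rewrite ler_pdivrMr ?ltr0n // ler_peMr ?ler1n // ltW.
    by move: (step n / _) => q; lra.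
  apply: le_trans (_ : \sum_(i < k) (step n + step n / k.+1%:R) <= 1).
    apply: ler_sum => i _; rewrite !mxE mulr1 lerD2l.
    by apply: le_trans (ler_norm _) (dle i).
  rewrite sumr_const card_ord -[leLHS]mulr_natl; apply: le_trans (stepk n).
  have k0 : 0 < k.+1%:R :> R by rewrite ltr0n.
  have -> : step n + step n / k.+1%:R = step n * (1 + k.+1%:R^-1).
    by rewrite mulrDr mulr1.
  rewrite mulrCA (mulrC k.+1%:R) ler_pM2l // mulrDr mulr1 -[leRHS]natr1 lerD2l.
  by rewrite ler_pdivrMr // mul1r ler_nat.
apply: near_enorm_cvg => e e0.
have M0 : 0 < enorm (b *m V) + 1 by rewrite ltr_wpDl ?enorm_ge0.
have small : \forall n \near \oo, n.+1%:R^-1 < e / (enorm (b *m V) + 1).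
  by apply: near_infty_natSinv_lt (PosNum (divr_gt0 e0 M0)).
apply: filterS small => n; rewrite ltr_pdivlMr //; apply: le_lt_trans.
rewrite addrC addKr -scalemxAl enormZ gtr0_norm //.
apply: ler_pM; rewrite ?enorm_ge0 ?lerDl ?(ltW (step0 n)) //.
by rewrite lef_pV2 ?posrE ?mulr_gt0 ?ltr0n // ler_peMl ?ler0n ?ler1n.
Qed.

End RelativeInterior.

(** * Strata and mirror stratifications *)

Section Strata.
Context {R : realType} {N : nat}.
Local Notation V := 'rV[R]_N.
Implicit Types (A M : set V) (S : set (set V)) (x u : V).

Lemma stratum_ofP A S x : stratified A S -> A x ->
  S (stratum_of S x) /\ stratum_of S x x.
Proof.
move=> [_ [cov _ _] _ _]; rewrite -cov => -[M SM Mx].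
rewrite /stratum_of /pblock /pblock_index.
by case: (@getPex _ [set M | S M /\ M x]); [exists M | ].
Qed.

Lemma stratum_of_eq A S M x : stratified A S -> S M -> M x ->
  stratum_of S x = M.
Proof.
move=> strat SM Mx; have Ax : A x.
  by have [_ [<- _ _] _ _] := strat; exists M.
have [SMx Mxx] := stratum_ofP strat Ax.
have [_ [_ triv _] _ _] := strat.
by apply: triv => //; exists x.
Qed.

Lemma prec_strata_trans M1 M2 M3 :
  prec_strata M1 M2 -> prec_strata M2 M3 -> prec_strata M1 M3.
Proof.
move=> M12 M23; apply: subset_trans M12 _.
rewrite ((closure_id (closure M3)).1 (@closed_closure _ M3)).
exact: closureS.
Qed.

(** A small neighborhood of x avoids the finitely many strata whose closure
    misses x; the frontier condition turns a common point of the stratum of x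
    and the closure of another one into an inclusion. *)
Lemma near_prec_strata A S x : stratified A S -> A x ->
  \forall y \near x, A y -> prec_strata (stratum_of S x) (stratum_of S y).
Proof.
move=> strat Ax; have [SMx Mxx] := stratum_ofP strat Ax.
have [Sfin _ frontier _] := strat.
have avoid M : S M -> \forall y \near x, M y -> prec_strata (stratum_of S x) M.
  move=> SM; have [clx|/existsNP[B /not_implyP[Bx MB]]] := pselect (closure M x).
    by apply: (@filterE _ (nbhs x)) => y _; apply/(frontier _ _ SMx SM); exists x.
  by apply: filterS Bx => y By My; case: MB; exists y.
have : \forall y \near x, forall M, S M -> M y ->
    prec_strata (stratum_of S x) M.
  move: Sfin => /finite_fsetP[F SF].
  have : nbhs x (\bigcap_(M in [set` F])
      [set z | M z -> prec_strata (stratum_of S x) M]).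
    apply: filter_bigI => M MF.
    by apply: avoid; rewrite SF.
  by apply: filterS => y Fy M SM; apply: Fy; rewrite -SF.
apply: filterS => y Sy Ay; have [SMy My] := stratum_ofP strat Ay.
exact: Sy.
Qed.

End Strata.

Section Mirror.
Context {R : realType} {N : nat}.
Variables (g : 'rV[R]_N -> \bar R) (S S' : set (set 'rV[R]_N)).
Hypotheses (gP : proper_fun g) (mirror : mirror_stratification g S S').
Implicit Types (x u : 'rV[R]_N).

Let strat : stratified (dom_subdiff g) S. Proof. by case: mirror. Qed.
Let strat' : stratified (dom_subdiff (conjugate g)) S'.
Proof. by case: mirror. Qed.

(** A subgradient at x is a limit of relatively interior subgradients at x,
    which lie in the mirror image of the stratum of x; the frontier condition
    between strata of the conjugate turns this common point of the stratum of u
    and a closure into an inclusion. *)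
Lemma prec_strata_Jmap x u : subdiff g x u ->
  prec_strata (stratum_of S' u) (Jmap g (stratum_of S x)).
Proof.
move=> ux; have [_ _ [Jfun _ _] _] := mirror.
have [SMx Mxx] : _ /\ _ := stratum_ofP strat (ex_intro _ u ux : dom_subdiff g x).
have u_dom : dom_subdiff (conjugate g) u by exists x; exact: subdiff_conjugate.
have [SMu Muu] := stratum_ofP strat' u_dom.
have [_ _ frontier' _] := strat'.
apply/(frontier' _ _ SMu (Jfun _ SMx)); exists u; split=> //.
have : closure (ri (subdiff g x)) u.
  by apply: sub_closure_ri ux; exact: subdiff_convex.
by apply: closureS => v uv; exists x.
Qed.

Lemma Jmap_Jinv M : S' M -> S (Jinv g S M) /\ Jmap g (Jinv g S M) = M.
Proof.
move=> SM; have [_ _ [_ Jinj Jsurj] _] := mirror.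
have [M0 SM0 <-] := Jsurj _ SM.
have -> : Jinv g S (Jmap g M0) = M0.
  exact: (pinvKV _ Jinj (mem_set SM0)).
by [].
Qed.

(** Identification of the strata. The lower bound on the stratum of x comes from
    x being close to xbar. The upper bound comes from the dual side: u is close
    to ubar, so the stratum of ubar precedes that of u, which precedes the mirror
    image of the stratum of x; the mirror map reverses the order. *)
Lemma near_Cset xbar ubar : subdiff g xbar ubar -> exists A B,
  [/\ nbhs xbar A, nbhs ubar B &
    forall x u, A x -> B u -> subdiff g x u -> Cset g S S' xbar ubar x].
Proof.
move=> ubarP; have xbar_dom : dom_subdiff g xbar by exists ubar.
have ubar_dom : dom_subdiff (conjugate g) ubar.
  by exists xbar; exact: subdiff_conjugate.
eexists; eexists; split; first exact: near_prec_strata strat xbar_dom.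
  exact: near_prec_strata strat' ubar_dom.
move=> x u xbar_x ubar_u ux.
have x_dom : dom_subdiff g x by exists u.
have [SMx Mxx] := stratum_ofP strat x_dom.
have [SMubar _] := stratum_ofP strat' ubar_dom.
have [SM JM] := Jmap_Jinv SMubar.
exists (stratum_of S x) => //; split=> //; split; first exact: xbar_x.
have [_ _ _ Jdecr] := mirror.
apply/Jdecr => //; rewrite JM; apply: prec_strata_trans (prec_strata_Jmap ux).
by apply: ubar_u; exists x; exact: subdiff_conjugate.
Qed.

(** In the nondegenerate case the stratum of ubar is the mirror image of that
    of xbar, so the chain of strata defining Cset collapses. *)
Lemma Cset_ri xbar ubar : ri (subdiff g xbar) ubar ->
  Cset g S S' xbar ubar = stratum_of S xbar.
Proof.
move=> ubar_ri; have [ubarP _] := ubar_ri.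
have xbar_dom : dom_subdiff g xbar by exists ubar.
have [SMx Mxx] := stratum_ofP strat xbar_dom.
have [_ _ [Jfun Jinj _] _] := mirror.
have Mubar : stratum_of S' ubar = Jmap g (stratum_of S xbar).
  by apply: (stratum_of_eq strat'); [exact: Jfun | exists xbar].
have Jx : Jinv g S (stratum_of S' ubar) = stratum_of S xbar.
  by rewrite Mubar; exact: (pinvKV _ Jinj (mem_set SMx)).
rewrite /Cset Jx; apply/seteqP; split=> [y [M [SM [xM Mx]] My]|y My].
  by have [_ _ _ antisym] := strat; rewrite (antisym _ _ SMx SM xM Mx).
by exists (stratum_of S xbar) => //; split=> //; split; exact: subset_closure.
Qed.

End Mirror.

(** * Convergence rates of scalar recursions *)

Section PowerTangents.
Context {R : realType}.
Implicit Types (a b t s : R).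

Lemma powRB1 a s : 0 < a -> a `^ (s - 1) = a `^ s / a.
Proof. by move=> a0; rewrite powRB ?powRr1 ?(ltW a0) // (gt_eqF a0) ?implybT. Qed.

Lemma powRV a s : 0 <= a -> a^-1 `^ s = (a `^ s)^-1.
Proof. by move=> a0; rewrite -powR_inv1 // -powRrM mulN1r powRN. Qed.

Lemma powR_div_norm a b s : 0 < a -> 0 <= b -> b `^ s = a `^ s * (b / a) `^ s.
Proof.
move=> a0 b0; rewrite -powRM ?divr_ge0 ?(ltW a0) //.
by rewrite mulrC divfK // gt_eqF.
Qed.

(** After normalization by a, this is the convexity inequality of the exponential
    between ln (b / a) and 0. *)
Lemma powR_concave_tangent a b s : 0 < a -> 0 <= b -> 0 < s <= 1 ->
  b `^ s <= a `^ s + s * a `^ (s - 1) * (b - a).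
Proof.
move=> a0 b0 /andP[s0 s1].
suff H t : 0 <= t -> t `^ s <= 1 + s * (t - 1).
  have := H (b / a) (divr_ge0 b0 (ltW a0)).
  rewrite -(ler_pM2l (powR_gt0 s a0)) -powR_div_norm // => /le_trans; apply.
  rewrite powRB1 // le_eqVlt; apply/orP; left; apply/eqP; field.
  by rewrite gt_eqF.
rewrite le_eqVlt => /predU1P[<-|t0].
  by rewrite powR0 ?gt_eqF //; lra.
have : expR (s * ln t + (1 - s) * 0) <= s * expR (ln t) + (1 - s) * expR 0.
  exact: convex_expR (Itv01 (ltW s0) s1) (ln t) 0.
by rewrite mulr0 addr0 expR0 lnK ?posrE // /powR gt_eqF //; lra.
Qed.

(** After normalization by a, this combines 1 + u <= exp u with ln t <= t - 1 at
    t = b / a. *)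
Lemma powR_convex_tangent a b s : 0 < a -> 0 < b -> 0 <= s ->
  a `^ (- s) + s * a `^ (- s - 1) * (a - b) <= b `^ (- s).
Proof.
move=> a0 b0 s0.
suff H t : 0 < t -> 1 + s * (1 - t) <= t `^ (- s).
  have := H (b / a) (divr_gt0 b0 a0).
  rewrite -(ler_pM2l (powR_gt0 (- s) a0)) -powR_div_norm ?(ltW b0) //.
  apply: le_trans.
  rewrite powRB1 // le_eqVlt; apply/orP; left; apply/eqP; field.
  by rewrite gt_eqF.
move=> t0; rewrite /powR gt_eqF //; apply: le_trans (expR_ge1Dx _).
have : ln (1 + (t - 1)) <= t - 1 by apply: le_ln1Dx; lra.
rewrite addrC subrK => /(ler_wpM2l s0); lra.
Qed.

End PowerTangents.

Section ValueRates.
Context {R : realType}.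
Variables (p k : R) (r : nat -> R).
Hypotheses (k0 : 0 < k) (r_ge0 : forall n, 0 <= r n).
Hypothesis rec : forall n, 0 < r n.+1 ->
  k * r n.+1 `^ (2 - 2 / p) <= r n - r n.+1.

Lemma value_nonincreasing n m : (n <= m)%N -> r m <= r n.
Proof.
move=> /subnK <-; elim: (m - n)%N => [|i IH] //=; rewrite addSn.
apply: le_trans IH; have [r0|] := ltP 0 (r (i + n).+1).
  rewrite -subr_ge0; apply: le_trans (rec r0).
  by rewrite mulr_ge0 ?powR_ge0 // ltW.
by move=> /le_trans; apply; exact: r_ge0.
Qed.

Lemma finite_rate n : p = 1 -> r 0 / k <= n%:R -> r n = 0.
Proof.
move=> p1; rewrite ler_pdivrMr // => r0n.
have decr m : 0 < r m -> m%:R * k + r m <= r 0.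
  elim: m => [|m IH] rm; first by rewrite mul0r add0r.
  have := rec rm; rewrite p1 divr1 subrr powRr0 mulr1 => step.
  have /IH : 0 < r m by apply: lt_le_trans rm (value_nonincreasing _).
  by rewrite -natr1; lra.
apply/eqP; rewrite eq_le r_ge0 andbT leNgt; apply/negP => rn.
by have := decr n rn; lra.
Qed.

Lemma superlinear_rate n : 1 < p -> r n.+1 <= (r n / k) `^ (p / (2 * (p - 1))).
Proof.
move=> p1; have [r0|] := ltP 0 (r n.+1); last first.
  by move=> /le_trans; apply; exact: powR_ge0.
have p0 : p != 0 by rewrite gt_eqF // (lt_trans ltr01).
have p10 : p - 1 != 0 by rewrite subr_eq0 gt_eqF.
have e0 : 0 <= p / (2 * (p - 1)) by rewrite divr_ge0 //; lra.
have -> : r n.+1 = (r n.+1 `^ (2 - 2 / p)) `^ (p / (2 * (p - 1))).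
  rewrite -powRrM (_ : _ * _ = 1) ?powRr1 ?r_ge0 //; field.
  by rewrite p0 p10.
apply: (ge0_ler_powR e0); rewrite ?nnegrE ?powR_ge0 ?divr_ge0 ?(ltW k0) //.
rewrite ler_pdivlMr // mulrC; apply: le_trans (rec r0) _.
by rewrite lerBlDr lerDl.
Qed.

Lemma linear_step n : p = 2 -> r n.+1 <= (1 + k)^-1 * r n.
Proof.
move=> p2; rewrite ler_pdivlMl ?addr_gt0 //.
have [r0|] := ltP 0 (r n.+1).
  have := rec r0; rewrite p2 mulfV ?pnatr_eq0 //.
  rewrite (_ : 2 - 1 = 1 :> R) ?powRr1 ?r_ge0 //; lra.
move=> rn; have -> : r n.+1 = 0 by apply/eqP; rewrite eq_le rn r_ge0.
by rewrite mulr0.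
Qed.

Lemma linear_rate n : p = 2 -> r n <= r 0 * (1 + k) `^ (- n%:R).
Proof.
move=> p2; have k1 : 0 < 1 + k by rewrite addr_gt0.
elim: n => [|n IH]; first by rewrite oppr0 powRr0 mulr1.
apply: le_trans (linear_step n p2) _; rewrite ler_pdivrMl //.
apply: le_trans IH _; rewrite le_eqVlt; apply/orP; left; apply/eqP.
rewrite -natr1 opprD powRB1 //; field.
by rewrite gt_eqF.
Qed.

(** With a = r n and b = r n.+1, the negative power r^(-(p-2)/p) grows by a
    fixed amount at each step. Either a and b are comparable, so that the
    tangent inequality turns the recursion into a lower bound for the growth,
    or b is smaller than a fixed fraction of a, so that the power grows at
    least geometrically; s is the threshold between the two cases. *)
Lemma inverse_power_step s n : 2 < p -> 1 <= s -> 0 < r n.+1 ->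
  Num.min k (k `^ ((p - 2) / (2 * p - 2))) * Cp'_objective p k (r 0) s
    <= r n.+1 `^ (- ((p - 2) / p)) - r n `^ (- ((p - 2) / p)).
Proof.
move=> p2 s1 b0; have p0 : p != 0 by rewrite gt_eqF //; lra.
have pm2 : 0 < p - 2 by lra.
have p22 : 0 < 2 * p - 2 by lra.
have s0 : 0 < s by lra.
have a0 : 0 < r n by apply: lt_le_trans b0 (value_nonincreasing _).
have a_r0 : r n <= r 0 by exact: value_nonincreasing.
have ba := rec b0.
set q := (p - 2) / (2 * p - 2); set e := (p - 2) / p.
have e0 : 0 < e by rewrite divr_gt0 //; lra.
have q0 : 0 < q by rewrite divr_gt0.
have -> : Cp'_objective p k (r 0) s
    = Num.min (e / s) (k `^ (- q) * r 0 `^ (- e) * (1 - s `^ (- q))).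
  rewrite /Cp'_objective -/q; congr (Num.min _ (k `^ _ * r 0 `^ _ * _)).
  - by rewrite /e invfM mulrA.
  - by rewrite /q -mulNr opprB.
  - by rewrite /e -mulNr opprB.
have s_q1 : s `^ (- q) <= 1.
  by rewrite powRN invf_le1 ?powR_gt0 // -(powRr0 s) ler_powR // ltW.
have min_ge0 : 0 <= Num.min k (k `^ q) by rewrite le_min powR_ge0 ltW.
have alphaE : 2 - 2 / p = e + 1 by rewrite /e; field.
rewrite alphaE in ba.
have [comparable|far] := leP (r n `^ (e + 1)) (s * r n.+1 `^ (e + 1)).
  apply: le_trans (_ : k * (e / s) <= _).
    apply: ler_pM => //; last by rewrite ge_min lexx.
      rewrite le_min divr_ge0 ?(ltW e0) ?(ltW s0) //=.
      by rewrite !mulr_ge0 ?powR_ge0 // subr_ge0.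
    by rewrite ge_min lexx.
  have := powR_convex_tangent a0 b0 (ltW e0); rewrite -lerBrDl; apply: le_trans.
  rewrite -opprD [_ `^ (- (e + 1))]powRN.
  have A0 := powR_gt0 (e + 1) a0; have B0 := powR_gt0 (e + 1) b0.
  move: (r n `^ (e + 1)) (r n.+1 `^ (e + 1)) comparable ba A0 B0.
  move=> a' b' comparable ba A0 B0.
  apply: le_trans (_ : e / a' * (k * b') <= _); last first.
    by rewrite ler_pM2l // mulr_gt0 ?invr_gt0.
  rewrite (_ : e / a' * (k * b') = k * (e * (a'^-1 * b'))); last by ring.
  rewrite !ler_pM2l // ler_pdivlMl // ler_pdivrMr // mulrC //.
apply: le_trans (_ : r 0 `^ (- e) * (1 - s `^ (- q)) <= _).
  apply: le_trans (_ : k `^ q *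
    (k `^ (- q) * r 0 `^ (- e) * (1 - s `^ (- q))) <= _).
    apply: ler_pM => //; last by rewrite ge_min lexx orbT.
      rewrite le_min divr_ge0 ?(ltW e0) ?(ltW s0) //=.
      by rewrite !mulr_ge0 ?powR_ge0 // subr_ge0.
    by rewrite ge_min lexx orbT.
  by rewrite !mulrA powRN mulfV ?mul1r // gt_eqF // powR_gt0.
have sq : s `^ q * r n `^ (- e) <= r n.+1 `^ (- e).
  have eE : e = (e + 1) * q by rewrite /e /q; field; rewrite p0 gt_eqF.
  rewrite eE -mulrN !(powRrM _ (e + 1)) !(powRN _ q) ler_pdivrMr ?powR_gt0 //.
  rewrite [leRHS]mulrC ler_pdivlMr ?powR_gt0 // -powRM ?powR_ge0 ?(ltW s0) //.
  apply: (ge0_ler_powR (ltW q0)); rewrite ?nnegrE ?mulr_ge0 ?powR_ge0 ?(ltW s0) //.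
  exact: ltW.
have a_e : r 0 `^ (- e) <= r n `^ (- e).
  rewrite !powRN lef_pV2 ?posrE ?powR_gt0 //; last exact: lt_le_trans a_r0.
  by apply: (ge0_ler_powR (ltW e0)); rewrite ?nnegrE ?r_ge0.
apply: le_trans (_ : r n `^ (- e) * (s `^ q - 1) <= _); last lra.
apply: ler_pM; rewrite ?powR_ge0 ?subr_ge0 // powRN.
have sq1 : 1 <= s `^ q by rewrite -(powRr0 s) ler_powR // ltW.
have sq0 : 0 < s `^ q by lra.
move: (s `^ q) sq1 sq0 => t t1 t0.
rewrite -(ler_pM2r t0) mulrBl mulVf ?gt_eqF // mul1r; nra.
Qed.

(** Summing the growth of the inverse power over n steps bounds it below by
    n / C. *)
Lemma sublinear_rate C n : 2 < p -> 0 < C -> Cp'_spec p k (r 0) C ->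
  (0 < n)%N -> r n <= C `^ (p / (p - 2)) * n%:R `^ (- (p / (p - 2))).
Proof.
move=> p2 C0 [_ [[s /= s1 <-] _] CE] n0.
have [rn0|] := ltP 0 (r n); last first.
  by move=> /le_trans; apply; rewrite mulr_ge0 ?powR_ge0.
have grows m : 0 < r m -> m%:R / C <= r m `^ (- ((p - 2) / p)).
  elim: m => [|m IH] rm; first by rewrite mul0r powR_ge0.
  have := inverse_power_step p2 s1 rm; rewrite -CE.
  have /IH : 0 < r m by apply: lt_le_trans rm (value_nonincreasing _).
  rewrite (_ : m.+1%:R / C = m%:R / C + C^-1); last first.
    by rewrite -natr1 mulrDl mul1r.
  by lra.
have N0 : 0 < n%:R :> R by rewrite ltr0n.
have e0 : 0 < p / (p - 2) by rewrite divr_gt0 //; lra.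
have -> : r n = (r n `^ (- ((p - 2) / p))) `^ (- (p / (p - 2))).
  rewrite -powRrM mulrNN (_ : _ * _ = 1) ?powRr1 ?r_ge0 //; field.
  by rewrite !gt_eqF //; lra.
rewrite !(powRN _ (p / (p - 2))) -{1}[C `^ _]invrK -invfM.
rewrite -(powRV _ (ltW C0)) -powRM ?invr_ge0 ?(ltW C0) ?(ltW N0) //.
rewrite lef_pV2 ?posrE ?powR_gt0 ?mulr_gt0 ?invr_gt0 //.
apply: (ge0_ler_powR (ltW e0)); rewrite ?nnegrE ?powR_ge0 //.
  by rewrite mulr_ge0 ?invr_ge0 ?(ltW C0) ?(ltW N0).
by rewrite mulrC grows.
Qed.

End ValueRates.

(** * Lengths and explicit constants *)

(** The drops of the energy W dominate the lengths of the steps, so the path that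
    starts at y n has total length at most W n. *)
Lemma enorm_limit_le_energy (R : realType) (N : nat) (y : nat -> 'rV[R]_N)
    (ybar : 'rV[R]_N) (W : nat -> R) :
  y @ \oo --> ybar -> (forall n, 0 <= W n) ->
  (forall n, enorm (y n.+1 - y n) <= W n - W n.+1) ->
  forall n, enorm (y n - ybar) <= W n.
Proof.
move=> ycvg W0 drop n.
have chain m : enorm (y (m + n)%N - y n) <= W n - W (m + n)%N.
  elim: m => [|m IH]; first by rewrite !subrr enorm0.
  have -> : y (m.+1 + n)%N - y n
      = (y (m + n).+1 - y (m + n)%N) + (y (m + n)%N - y n).
    by rewrite addrA subrK.
  by have := enormD (y (m + n).+1 - y (m + n)%N) (y (m + n)%N - y n);
    have := drop (m + n)%N; rewrite addSn; lra.
apply/ler_addgt0Pr => e e0.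
have [m _ far] := cvg_near_enorm ycvg e0.
have := far (m + n)%N (leq_addr _ _).
have -> : y n - ybar = - (y (m + n)%N - y n) + (y (m + n)%N - ybar).
  by rewrite opprB addrA subrK.
have := enormD (- (y (m + n)%N - y n)) (y (m + n)%N - ybar); rewrite enormN.
by have := chain m; have := W0 (m + n)%N; lra.
Qed.

Section LojasiewiczSequences.
Context {R : realType}.
Variables (p c lam sigma : R) (r a : nat -> R).
Hypotheses (p1 : 1 <= p) (c0 : 0 < c) (lam0 : 0 < lam) (sigma0 : 0 < sigma).
Hypotheses (r_ge0 : forall n, 0 <= r n) (a_ge0 : forall n, 0 <= a n).
Hypothesis drop : forall n, sigma * a n ^+ 2 <= r n - r n.+1.
Hypothesis loja : forall n, 0 < r n.+1 ->
  r n.+1 `^ (1 - p^-1) <= c * (a n / lam).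

Lemma value_recursion n : 0 < r n.+1 ->
  lam ^+ 2 * sigma / c ^+ 2 * r n.+1 `^ (2 - 2 / p) <= r n - r n.+1.
Proof.
move=> r0; apply: le_trans (drop n).
have -> : r n.+1 `^ (2 - 2 / p) = (r n.+1 `^ (1 - p^-1)) ^+ 2.
  by rewrite -powR_mulrn ?powR_ge0 // -powRrM mulrBl mul1r [_^-1 * _]mulrC.
have sq : (r n.+1 `^ (1 - p^-1)) ^+ 2 <= (c * (a n / lam)) ^+ 2.
  rewrite ler_sqr ?nnegrE ?powR_ge0 ?loja //.
  by rewrite !mulr_ge0 ?invr_ge0 ?(ltW c0) ?(ltW lam0).
apply: le_trans (_ : lam ^+ 2 * sigma / c ^+ 2 * (c * (a n / lam)) ^+ 2 <= _).
  by rewrite ler_pM2l // divr_gt0 ?mulr_gt0 ?exprn_gt0.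
rewrite le_eqVlt; apply/orP; left; apply/eqP; field.
by rewrite !gt_eqF.
Qed.

(** The second summand is a multiple of p c t^(1/p), the desingularizing function
    of the Lojasiewicz inequality, at t = r n.+1. *)
Definition energy n : R := a n + (sigma * lam)^-1 * (p * c * r n.+1 `^ p^-1).

Lemma energy_ge0 n : 0 <= energy n.
Proof.
rewrite addr_ge0 // mulr_ge0 ?invr_ge0 ?mulr_ge0 ?powR_ge0 ?ltW //.
exact: lt_le_trans p1.
Qed.

(** By concavity and the Lojasiewicz inequality, the second summand of the energy
    drops by at least (a n.+1)^2 / a n; by the inequality between the arithmetic
    and geometric means, this drop is thus at least 2 (a n.+1) - a n. *)
Lemma energy_drop n : a n.+1 <= energy n - energy n.+1.
Proof.
have p0 : 0 < p by exact: lt_le_trans p1.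
have D0 : 0 < (sigma * lam)^-1 by rewrite invr_gt0 mulr_gt0.
have := drop n.+1; have := a_ge0 n.+1; have := a_ge0 n; rewrite /energy.
have [r1|] := ltP 0 (r n.+1); last first.
  move=> r1_le; have r1 : r n.+1 = 0 by apply/eqP; rewrite eq_le r1_le r_ge0.
  move=> an0 an1 dr; have r2 : r n.+2 = 0.
    apply/eqP; rewrite eq_le r_ge0 andbT; move: dr; rewrite r1.
    by have := mulr_ge0 (ltW sigma0) (sqr_ge0 (a n.+1)); lra.
  move: dr; rewrite r1 r2 subrr pmulr_rle0 // => sq_le0.
  have /eqP : a n.+1 ^+ 2 = 0 by apply/eqP; rewrite eq_le sq_le0 sqr_ge0.
  by rewrite sqrf_eq0 => /eqP ->; lra.
move=> an0 an1 dr.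
have lo := loja r1.
have P0 : 0 < r n.+1 `^ (1 - p^-1) by exact: powR_gt0.
have an : 0 < a n.
  rewrite lt_neqAle an0 andbT; apply/eqP => an'.
  by move: lo; rewrite -an' mul0r mulr0 leNgt P0.
have pinv : 0 < p^-1 <= 1 by rewrite invr_gt0 p0 invf_le1.
have := powR_concave_tangent r1 (r_ge0 n.+2) pinv.
have -> : r n.+1 `^ (p^-1 - 1) = (r n.+1 `^ (1 - p^-1))^-1.
  by rewrite -powRN opprB.
move: (r n.+1 `^ p^-1) (r n.+2 `^ p^-1) => F1 F2 conc.
set P := r n.+1 `^ (1 - p^-1) in P0 lo conc.
(* The tangent inequality for t^(1/p) at r n.+1, multiplied by p * P. *)
have concP : p * P * (F1 - F2) >= r n.+1 - r n.+2.
  have : p * P * F2 <= p * P * (F1 + p^-1 * P^-1 * (r n.+2 - r n.+1)).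
    by rewrite ler_pM2l // mulr_gt0.
  have -> : p * P * (F1 + p^-1 * P^-1 * (r n.+2 - r n.+1))
      = p * P * F1 + (r n.+2 - r n.+1) by field; rewrite !gt_eqF.
  by rewrite mulrBr; lra.
have F12 : 0 <= F1 - F2.
  rewrite -(pmulr_rge0 _ (mulr_gt0 p0 P0)); apply: le_trans concP.
  by apply: le_trans dr; rewrite mulr_ge0 ?sqr_ge0 // ltW.
set X := (sigma * lam)^-1 * (p * c * (F1 - F2)).
have sqX : a n.+1 ^+ 2 <= a n * X.
  rewrite -(ler_pM2l sigma0); apply: le_trans dr _; apply: le_trans concP _.
  have -> : sigma * (a n * X) = p * (c * (a n / lam)) * (F1 - F2).
    by rewrite /X; field; rewrite !gt_eqF.
  by rewrite ler_wpM2r // ler_pM2l.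
have -> : a n + (sigma * lam)^-1 * (p * c * F1)
    - (a n.+1 + (sigma * lam)^-1 * (p * c * F2)) = a n + X - a n.+1.
  by rewrite /X; ring.
have X0 : 0 <= X by rewrite /X !mulr_ge0 // ltW.
suff : 2 * a n.+1 <= a n + X by lra.
have aX0 : 0 <= a n + X by rewrite addr_ge0.
have a1 : 0 <= 2 * a n.+1 by rewrite mulr_ge0.
rewrite -ler_sqr ?nnegrE //.
by have := sqr_ge0 (a n - X); nra.
Qed.

Lemma energy_le n : energy n <=
  sigma `^ (- 2^-1) * r n `^ 2^-1 + (sigma * lam)^-1 * (p * c * r n `^ p^-1).
Proof.
have r1n : r n.+1 <= r n.
  rewrite -subr_ge0; apply: le_trans (drop n).
  by rewrite mulr_ge0 ?sqr_ge0 // ltW.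
have p0 : 0 < p by exact: lt_le_trans p1.
apply: lerD; last first.
  rewrite ler_pM2l ?invr_gt0 ?mulr_gt0 // ler_pM2l ?mulr_gt0 //.
  by apply: ge0_ler_powR; rewrite ?nnegrE ?r_ge0 ?invr_ge0 ?(ltW p0).
rewrite powRN !powR12_sqrt ?(ltW sigma0) // -sqrtrV ?(ltW sigma0) //.
rewrite -sqrtrM ?invr_ge0 ?(ltW sigma0) //.
rewrite -[leLHS]ger0_norm // -sqrtr_sqr ler_wsqrtr // ler_pdivlMl //.
by apply: le_trans (drop n) _; rewrite lerBlDr lerDl.
Qed.

End LojasiewiczSequences.

Section Constants.
Context {R : realType}.
Implicit Types (p c lam L k r t : R).

Lemma powR_le_lower_exponent (t t0 u v : R) : 0 <= t <= t0 -> 0 < t0 ->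
  0 < u <= v -> t `^ v <= t0 `^ v * t0 `^ (- u) * t `^ u.
Proof.
move=> /andP[t_ge0 tt0] t00 /andP[u0 uv].
have v0 : 0 < v by exact: lt_le_trans uv.
move: t_ge0; rewrite le_eqVlt => /predU1P[<-|tp].
  by rewrite !powR0 ?gt_eqF // mulr0.
have -> : t `^ v = t `^ (v - u) * t `^ u.
  by rewrite -powRD ?subrK // (gt_eqF tp) implybT.
rewrite ler_pM2r ?powR_gt0 // -powRD; last by rewrite (gt_eqF t00) implybT.
by apply: ge0_ler_powR; rewrite ?nnegrE ?subr_ge0 ?(ltW tp) ?(ltW t00).
Qed.

Lemma Cp_ge2_gt0 p c lam L r0 : 1 <= p -> 0 < c -> 0 < lam -> lam * L < 2 ->
  0 < r0 -> 0 < Cp_ge2 p c lam L r0.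
Proof.
move=> p1 c0 lam0 lamL r00; have d0 : 0 < 2 - lam * L by lra.
have p0 : 0 < p by exact: lt_le_trans p1.
by rewrite /Cp_ge2 addr_gt0 // !mulr_gt0 ?invr_gt0 ?powR_gt0 ?mulr_gt0.
Qed.

Lemma Cp_le2_gt0 p c lam L r0 : 1 <= p -> 0 < c -> 0 < lam -> lam * L < 2 ->
  0 < r0 -> 0 < Cp_le2 p c lam L r0.
Proof.
move=> p1 c0 lam0 lamL r00; have d0 : 0 < 2 - lam * L by lra.
have p0 : 0 < p by exact: lt_le_trans p1.
by rewrite /Cp_le2 addr_gt0 // !mulr_gt0 ?invr_gt0 ?powR_gt0 ?mulr_gt0.
Qed.

Lemma Cp_le2_ge2 c lam L r0 : 0 < lam -> lam * L < 2 -> 0 < r0 ->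
  Cp_le2 2 c lam L r0 = Cp_ge2 2 c lam L r0.
Proof.
move=> lam0 lamL r00; rewrite /Cp_le2 /Cp_ge2.
rewrite (powRM _ _ (ltW r00)) ?mulr_ge0 ?(ltW lam0) // !(powRN r0).
have := powR_gt0 2^-1 r00; move: (r0 `^ 2^-1) (_ `^ _) (_ `^ _) => s u v s0.
by field; rewrite !gt_eqF //; lra.
Qed.

(** The first term of the objective decreases with s; the second one increases
    from 0 and ends up above it, so the maximum of their minimum is attained
    where they cross. The intermediate value theorem is applied in the variable
    ln s. *)
Lemma exists_Cp'_max p k r0 : 2 < p -> 0 < k -> 0 < r0 -> exists s,
  [/\ 1 <= s, 0 < Cp'_objective p k r0 s &
    is_max [set Cp'_objective p k r0 s | s in [set s | 1 <= s]]
      (Cp'_objective p k r0 s)].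
Proof.
move=> p2 k0 r00.
set q := (p - 2) / (2 * p - 2); set b := (p - 2) / p.
have q0 : 0 < q by rewrite divr_gt0 //; lra.
have b0 : 0 < b by rewrite divr_gt0 //; lra.
set A := k `^ ((2 - p) / (2 * p - 2)) * r0 `^ ((2 - p) / p).
have A0 : 0 < A by rewrite mulr_gt0 ?powR_gt0.
have objE s : Cp'_objective p k r0 s = Num.min (b / s) (A * (1 - s `^ (- q))).
  by rewrite /Cp'_objective -/q -/A /b invfM mulrA.
pose F (t : R) := A * (1 - expR (- q * t)) - b * expR (- t).
have Fcont : continuous F.
  move=> t; apply: cvgB; apply: cvgM; try exact: cvg_cst.
    apply: cvgB; first exact: cvg_cst.
    apply: continuous_comp; last exact: continuous_expR.
    by apply: cvgM; [exact: cvg_cst | exact: cvg_id].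
  apply: continuous_comp; last exact: continuous_expR.
  by apply: cvgN; exact: cvg_id.
pose T := q^-1 + 2 * b / A.
have T0 : 0 < T by rewrite addr_gt0 ?invr_gt0 // divr_gt0 // mulr_gt0.
have F0 : F 0 <= 0 by rewrite /F mulr0 oppr0 expR0 subrr mulr0 mulr1; lra.
have FT : 0 <= F T.
  have half : expR (- q * T) <= 2^-1.
    rewrite mulNr expRN lef_pV2 ?posrE ?expR_gt0 //.
    apply: le_trans (expR_ge1Dx _); rewrite /T mulrDr mulfV ?gt_eqF //.
    have : 0 <= q * (2 * b / A) by rewrite ltW // mulr_gt0 // divr_gt0 // mulr_gt0.
    by lra.
  have small : b * expR (- T) <= A / 2.
    rewrite expRN ler_pdivrMr ?expR_gt0 //.
    apply: le_trans (_ : A / 2 * T <= _); last first.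
      rewrite ler_pM2l ?divr_gt0 //; apply: le_trans (expR_ge1Dx _).
      by rewrite lerDr.
    rewrite /T mulrDr; have -> : A / 2 * (2 * b / A) = b by field; rewrite gt_eqF.
    by rewrite lerDr ltW // mulr_gt0 ?invr_gt0 // divr_gt0.
  have : A * 2^-1 <= A * (1 - expR (- q * T)) by rewrite ler_pM2l //; lra.
  by rewrite /F; lra.
have [t] : exists2 t, t \in `[0, T] & F t = 0.
  apply: IVT; rewrite ?(ltW T0) //; first exact: continuous_subspaceT.
  by rewrite ge_min F0 le_max FT orbT.
rewrite in_itv /= => /andP[t0 _] Ft.
have s0 := expR_gt0 t; have s1 : 1 <= expR t.
  by apply: le_trans (expR_ge1Dx t); rewrite lerDl.
have cross : A * (1 - expR t `^ (- q)) = b / expR t.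
  by move: Ft; rewrite /F -expRM [t * _]mulrC -expRN => /subr0_eq.
exists (expR t); split=> //; first by rewrite objE cross minxx divr_gt0.
split=> [|_ [s /= s_ge1 <-]]; first by exists (expR t).
have sp : 0 < s by exact: lt_le_trans s_ge1.
rewrite !objE cross minxx ge_min; have [le_s|lt_s] := leP (expR t) s.
  by rewrite ler_pM2l // lef_pV2 ?posrE // le_s.
rewrite -cross ler_pM2l // lerD2l lerN2 !powRN lef_pV2 ?posrE ?powR_gt0 //.
apply/orP; right; apply: ge0_ler_powR; rewrite ?nnegrE ?(ltW sp) ?(ltW s0) //.
  exact: ltW.
exact: ltW.
Qed.

Lemma exists_Cp' p k r0 : 0 < k -> 0 < r0 ->
  exists2 C, 0 < C & 2 < p -> Cp'_spec p k r0 C.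
Proof.
move=> k0 r00; have [p2|p2] := ltP 2 p; last by exists 1.
have [s [_ obj0 obj_max]] := exists_Cp'_max p2 k0 r00.
have min0 : 0 < Num.min k (k `^ ((p - 2) / (2 * p - 2))).
  by rewrite lt_min k0 powR_gt0.
exists (Num.min k (k `^ ((p - 2) / (2 * p - 2))) * Cp'_objective p k r0 s)^-1.
  by rewrite invr_gt0 mulr_gt0.
by exists (Cp'_objective p k r0 s); rewrite ?invrK.
Qed.

(** The right-hand side of energy_le, for the constants of the
    forward-backward iteration. *)
Definition energy_bound p c lam L t : R :=
  ((2 - lam * L) / (2 * lam)) `^ (- 2^-1) * t `^ 2^-1
  + ((2 - lam * L) / (2 * lam) * lam)^-1 * (p * c * t `^ p^-1).

Section EnergyBounds.
Variables (p c lam L r0 t : R).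
Hypotheses (p1 : 1 <= p) (c0 : 0 < c) (lam0 : 0 < lam) (lamL : lam * L < 2).
Hypotheses (r00 : 0 < r0) (t_r0 : 0 <= t <= r0).

Let d0 : 0 < 2 - lam * L. Proof. by rewrite subr_gt0. Qed.
Let p0 : 0 < p. Proof. exact: lt_le_trans p1. Qed.

Lemma energy_boundE : energy_bound p c lam L t =
  (2 * lam) `^ 2^-1 * (2 - lam * L) `^ (- 2^-1) * t `^ 2^-1
  + 2 * p * c * (2 - lam * L)^-1 * t `^ p^-1.
Proof.
rewrite /energy_bound; congr (_ * _ + _).
  rewrite !powRN [in LHS]powRM ?invr_ge0 ?mulr_ge0 ?(ltW lam0) ?(ltW d0) //.
  by rewrite powRV ?mulr_ge0 ?(ltW lam0) // invfM invrK mulrC.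
by field; rewrite !gt_eqF.
Qed.

Lemma energy_bound_le2 : p <= 2 ->
  energy_bound p c lam L t <= Cp_le2 p c lam L r0 * t `^ 2^-1.
Proof.
move=> p2; rewrite energy_boundE /Cp_le2 (mulrDl _ _ (t `^ 2^-1)).
rewrite [leRHS]addrC lerD2l.
have uv : 0 < (2^-1 : R) <= p^-1.
  by apply/andP; split; [rewrite invr_gt0 | rewrite lef_pV2 ?posrE].
have := powR_le_lower_exponent t_r0 r00 uv.
have A0 : 0 <= 2 * p * c * (2 - lam * L)^-1.
  by rewrite !mulr_ge0 ?invr_ge0 ?(ltW c0) ?(ltW p0) ?(ltW d0).
move=> /(ler_wpM2l A0) /le_trans; apply; rewrite le_eqVlt; apply/orP; left.
by apply/eqP; ring.
Qed.

Lemma energy_bound_ge2 : 2 <= p ->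
  energy_bound p c lam L t <= Cp_ge2 p c lam L r0 * t `^ p^-1.
Proof.
move=> p2; rewrite energy_boundE /Cp_ge2 (mulrDl _ _ (t `^ p^-1)).
rewrite [leLHS]addrC lerD2l.
have uv : 0 < p^-1 <= 2^-1.
  by apply/andP; split; [rewrite invr_gt0 | rewrite lef_pV2 ?posrE].
have := powR_le_lower_exponent t_r0 r00 uv.
have B0 : 0 <= (2 * lam) `^ 2^-1 * (2 - lam * L) `^ (- 2^-1).
  by rewrite mulr_ge0 ?powR_ge0.
move=> /(ler_wpM2l B0) /le_trans; apply; rewrite le_eqVlt; apply/orP; left.
rewrite (powRM _ _ (ltW r00)) ?mulr_ge0 ?(ltW lam0) //.
by apply/eqP; ring.
Qed.

End EnergyBounds.
End Constants.

(** * The forward-backward iteration *)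

Section ForwardBackward.
Context {R : realType} {N : nat}.
Variables (g : 'rV[R]_N -> \bar R) (h : 'rV[R]_N -> R) (L lam : R).
Hypotheses (gP : proper_fun g) (gC : convex_efun g).
Hypotheses (hdiff : forall z, differentiable h z)
  (hconv : convex_function [set: convex_lmodType 'rV[R]_N] h)
  (L0 : 0 < L)
  (hlip : forall z w, enorm (grad h z - grad h w) <= L * enorm (z - w))
  (lam0 : 0 < lam) (lamL : lam * L < 2).
Let f z := (g z + (h z)%:E)%E.
Implicit Types (z w : 'rV[R]_N).

Definition fb_subgradient z w : 'rV[R]_N :=
  lam^-1 *: (z - lam *: grad h z - w).

Lemma fb_subgradientP z w :
  prox lam g (z - lam *: grad h z) w -> subdiff g w (fb_subgradient z w).
Proof. exact: prox_subdiff. Qed.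

(** The subgradient inequality for g at w, tested at z, and the descent lemma
    for h add up to the decrease of f. *)
Lemma fb_descent z w : g z \is a fin_num ->
  prox lam g (z - lam *: grad h z) w ->
  (2 - lam * L) / (2 * lam) * enorm (w - z) ^+ 2 <= fine (f z) - fine (f w).
Proof.
move=> gz /fb_subgradientP /(subdiffP w _ gP)[gw /(_ z gz)].
have := descent_lemma hdiff hlip z (w - z).
have -> : z + (w - z) = w by rewrite addrC subrK.
rewrite /f !fine_sum // enorm_sqr /fb_subgradient.
have -> : z - lam *: grad h z - w = - (w - z) - lam *: grad h z.
  by rewrite opprB addrAC.
have -> : z - w = - (w - z) by rewrite opprB.
move: (w - z) => d; rewrite dotvZl dotvDl !dotvNl !dotvNr opprK dotvZl mulrDr.
rewrite opprK mulrA mulVf ?gt_eqF // mul1r => hd gd.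
have -> : (2 - lam * L) / (2 * lam) * dotv d d
    = lam^-1 * dotv d d - L / 2 * dotv d d by field; rewrite gt_eqF.
by lra.
Qed.

(** Adding the gradient at w turns the subgradient of g at w provided by the
    proximal step into a subgradient of f, which is lam^-1 times the difference
    of the gradient steps from z and w; gradient steps are nonexpansive. *)
Lemma fb_dist_subdiff z w : prox lam g (z - lam *: grad h z) w ->
  (dist_set 0 (subdiff f w) <= (enorm (w - z) / lam)%:E)%E.
Proof.
move=> /fb_subgradientP/(subdiff_sum gP hdiff hconv) wP.
apply: le_trans (ereal_inf_lbound _) _.
  by exists (fb_subgradient z w + grad h w).
rewrite lee_fin subr0.
have -> : fb_subgradient z w + grad h w
    = lam^-1 *: ((z - lam *: grad h z) - (w - lam *: grad h w)).
  rewrite /fb_subgradient opprB addrA (addrAC _ (lam *: grad h w)).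
  by rewrite [in RHS]scalerDr scalerA mulVf ?scale1r // gt_eqF.
rewrite enormZ gtr0_norm ?invr_gt0 // mulrC ler_pM2r ?invr_gt0 // (enormBC w).
apply: (gradient_step_nonexpansive hdiff L0 hlip hconv).
by rewrite (ltW lam0) ler_pdivlMr // ltW.
Qed.

Lemma fb_subgradient_cvg (x : nat -> 'rV[R]_N) xbar : x @ \oo --> xbar ->
  fb_subgradient (x n) (x n.+1) @[n --> \oo] --> - grad h xbar.
Proof.
move=> xcvg; have gradcvg : grad h (x n) @[n --> \oo] --> grad h xbar.
  apply: near_enorm_cvg => e e0.
  apply: filterS (cvg_near_enorm xcvg (divr_gt0 e0 L0)) => n.
  rewrite ltr_pdivlMr // mulrC; exact: le_lt_trans.
have -> : - grad h xbar = lam^-1 *: (xbar - lam *: grad h xbar - xbar).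
  by rewrite addrAC subrr add0r scalerN scalerA mulVf ?scale1r // gt_eqF.
apply: cvgZ; first exact: cvg_cst.
apply: cvgB; last by rewrite (cvg_shiftS x).
by apply: cvgB => //; apply: cvgZ => //; exact: cvg_cst.
Qed.

End ForwardBackward.

Lemma einf_argmin (R : realType) (N : nat) (f : 'rV[R]_N -> \bar R) z :
  argmin f z -> einf f = f z.
Proof.
move=> zmin; apply/eqP; rewrite eq_le; apply/andP; split.
  by apply: ereal_inf_lbound; exists z.
by apply: le_ereal_inf_tmp => _ [w _ <-]; exact: zmin.
Qed.

Lemma epowR_ge0 (R : realType) (a s : R) : (0 <= epowR a s)%E.
Proof. by rewrite /epowR; case: ifP => // _; rewrite lee_fin powR_ge0. Qed.

Section LojasiewiczIterates.
Context {R : realType} {N : nat}.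
Variables (p c lam L : R) (y : nat -> 'rV[R]_N) (ybar : 'rV[R]_N).
Variable r : nat -> R.
Hypotheses (p1 : 1 <= p) (c0 : 0 < c) (lam0 : 0 < lam) (lamL : lam * L < 2).
Hypotheses (ycvg : y @ \oo --> ybar) (r_ge0 : forall n, 0 <= r n).
Hypothesis drop : forall n,
  (2 - lam * L) / (2 * lam) * enorm (y n.+1 - y n) ^+ 2 <= r n - r n.+1.
Hypothesis loja : forall n, 0 < r n.+1 ->
  r n.+1 `^ (1 - p^-1) <= c * (enorm (y n.+1 - y n) / lam).

Let d0 : 0 < 2 - lam * L. Proof. by rewrite subr_gt0. Qed.
Let sigma0 : 0 < (2 - lam * L) / (2 * lam).
Proof. by rewrite divr_gt0 ?mulr_gt0. Qed.

Lemma kappa_gt0 : 0 < kappa lam L c.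
Proof. by rewrite /kappa !mulr_gt0 ?invr_gt0 ?mulr_gt0 ?exprn_gt0. Qed.

Lemma iterates_recursion n : 0 < r n.+1 ->
  kappa lam L c * r n.+1 `^ (2 - 2 / p) <= r n - r n.+1.
Proof.
move=> rn; have a_ge0 m : 0 <= enorm (y m.+1 - y m) by exact: enorm_ge0.
have -> : kappa lam L c
    = lam ^+ 2 * ((2 - lam * L) / (2 * lam)) / c ^+ 2.
  by rewrite /kappa; field; rewrite !gt_eqF.
exact: (value_recursion c0 lam0 sigma0 a_ge0 drop loja rn).
Qed.

Lemma iterates_dist n : enorm (y n.+1 - ybar) <= energy_bound p c lam L (r n).
Proof.
have a_ge0 m : 0 <= enorm (y m.+1 - y m) by exact: enorm_ge0.
apply: le_trans (energy_le p1 c0 lam0 sigma0 r_ge0 a_ge0 drop n).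
apply: (enorm_limit_le_energy (y := fun n => y n.+1)).
- by rewrite (cvg_shiftS y).
- by move=> m; apply: energy_ge0.
- by move=> m; apply: energy_drop.
Qed.

(** Once the optimal value is reached the next step has length 0, and the bound
    on the distance from there to the limit vanishes. *)
Lemma iterates_eq_limit n : r n = 0 -> y n = ybar.
Proof.
move=> rn; have := drop n; rewrite rn sub0r => dn.
have : enorm (y n.+1 - y n) ^+ 2 <= 0.
  rewrite -(pmulr_rle0 _ sigma0); apply: le_trans dn _.
  by rewrite oppr_le0 r_ge0.
rewrite le_eqVlt ltNge sqr_ge0 orbF sqrf_eq0 => /eqP/enorm_eq0/subr0_eq <-.
have := iterates_dist n; rewrite rn /energy_bound !powR0 ?invr_eq0 ?pnatr_eq0 //.
  rewrite !mulr0 addr0 => dle.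
  apply/subr0_eq/enorm_eq0/eqP.
  by rewrite eq_le dle enorm_ge0.
by rewrite gt_eqF // (lt_le_trans _ p1).
Qed.

End LojasiewiczIterates.

Theorem corollary4p15 (R : realType) (N : nat)
  (g : 'rV[R]_N -> \bar R) (h : 'rV[R]_N -> R) (L lam : R)
  (x : nat -> 'rV[R]_N) (xbar : 'rV[R]_N)
  (S S' : set (set 'rV[R]_N)) (p c : R) (delta : \bar R)
  (f := fun z : 'rV[R]_N => (g z + (h z)%:E)%E)
  (Cbar := Cset g S S' xbar (- grad h xbar)) :
  Gamma0 g ->
  convex_function [set: convex_lmodType 'rV[R]_N] h ->
  (forall z, differentiable h z) ->
  0 < L ->
  (forall z w, enorm (grad h z - grad h w) <= L * enorm (z - w)) ->
  0 < lam < 2 * L^-1 ->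
  (forall n, prox lam g (x n - lam *: grad h (x n)) (x n.+1)) ->
  x @ \oo --> xbar ->
  argmin f xbar ->
  mirror_stratification g S S' ->
  (0 < delta)%E -> 1 <= p -> 0 < c ->
  lojasiewicz p c f (Cbar `&` eball xbar delta) ->
  (exists n0 : nat,
    let y := fun n => x (n0 + n)%N in
    let r := fun n => (f (y n) - einf f)%E in
    let k := kappa lam L c in
    exists Cp Cp' : R,
    [/\ 0 < Cp, 0 < Cp',
      ((0 < r 0%N < +oo)%E ->
        [/\ (2 <= p -> Cp = Cp_ge2 p c lam L (fine (r 0%N))),
            (p <= 2 -> Cp = Cp_le2 p c lam L (fine (r 0%N))) &
            (2 < p -> Cp'_spec p k (fine (r 0%N)) Cp')]) &
      [/\ (p = 1 -> forall n : nat,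
             (r 0%N * (k^-1)%:E <= n%:R%:E)%E -> y n = xbar),
          (1 < p < 2 -> forall n : nat,
             (r n.+1 <= (r n * (k^-1)%:E) `^ (p / (2 * (p - 1))))%E /\
             ((enorm (y n.+1 - xbar))%:E <= Cp%:E * r n `^ 2^-1)%E),
          (p = 2 -> forall n : nat,
             (r n.+1 <= (1 + k)^-1%:E * r n)%E /\
             ((enorm (y n.+1 - xbar))%:E
                <= Cp%:E * r 0%N `^ 2^-1 * ((1 + k) `^ (- (n%:R / 2)))%:E)%E) &
          (2 < p -> forall n : nat,
             (r n <= (Cp' `^ (p / (p - 2)))%:E
                       * epowR n%:R (- (p / (p - 2))))%E /\
             ((enorm (y n.+1 - xbar))%:E
                <= Cp%:E * (Cp' `^ (p - 2)^-1)%:E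
                     * epowR n%:R (- (p - 2)^-1))%E)]]) /\
  (ri (subdiff f xbar) 0 -> Cbar = stratum_of S xbar).
Proof.
move=> [gP gC _] hconv hdiff L0 hlip /andP[lam0 lamL'] xP xcvg xmin mirror
  delta0 p1 c0 loj.
have lamL : lam * L < 2 by rewrite -ltr_pdivlMr.
have ubarP : subdiff g xbar (- grad h xbar).
  rewrite -sub0r; apply: (subdiff_sum_inv gP gC hdiff hlip).
  exact/argmin_subdiff.
split; last first.
  move=> ri0; apply: Cset_ri => //; rewrite -sub0r.
  apply: ri_translate ri0 => u; split; first exact: subdiff_sum_inv.
  by move=> /(subdiff_sum gP hdiff hconv); rewrite subrK.
have gxbar : g xbar \is a fin_num by have [] := (subdiffP _ _ gP).1 ubarP.
have gx n : g (x n.+1) \is a fin_num.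
  by have /(subdiffP _ _ gP)[] := fb_subgradientP gP gC lam0 (xP n).
have [m mloj] : exists m, forall n, (m <= n)%N ->
    (Cbar `&` eball xbar delta) (x n.+1).
  have [A [B [xA uB AB]]] := near_Cset gP mirror ubarP.
  have xcvg1 : x n.+1 @[n --> \oo] --> xbar by rewrite (cvg_shiftS x).
  have ucvg := fb_subgradient_cvg L0 hlip lam0 xcvg.
  have [e e0 edelta] : exists2 e : R, 0 < e & (e%:E <= delta)%E.
    case: (delta) delta0 => [d||] //; first by exists d.
    by move=> _; exists 1; rewrite ?leey.
  have near_ball := cvg_near_enorm xcvg1 e0.
  have [m _ mP] : \forall n \near \oo, [/\ A (x n.+1),
      B (fb_subgradient h lam (x n) (x n.+1)) & enorm (x n.+1 - xbar) < e].
    by near=> n; split; near: n; [exact: xcvg1 xA | exact: ucvg uB | ].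
  exists m => n /mP[Axn Bun xball]; split; last first.
    by apply: lt_le_trans edelta; rewrite lte_fin.
  by apply: (AB _ _ Axn Bun); exact: fb_subgradientP.
(* The value of f at x 0 may be infinite: the shift is at least 1. *)
pose y n := x (m.+1 + n)%N.
have fbar := einf_argmin xmin.
pose rr n := fine (f (y n)) - fine (f xbar).
have ffin z : g z \is a fin_num -> f z \is a fin_num by rewrite fin_num_sum.
have yfin n : g (y n) \is a fin_num by exact: gx.
have rE n : (f (y n) - einf f)%E = (rr n)%:E.
  by rewrite fbar /rr EFinB !fineK ?ffin.
have rr_ge0 n : 0 <= rr n.
  by rewrite subr_ge0 fine_le ?ffin //; exact: xmin.
have drop n : (2 - lam * L) / (2 * lam) * enorm (y n.+1 - y n) ^+ 2
    <= rr n - rr n.+1.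
  have -> : rr n - rr n.+1 = fine (f (y n)) - fine (f (y n.+1)).
    by rewrite /rr opprB addrA subrK.
  apply: (fb_descent gP gC hdiff hlip lam0) => //.
  by rewrite /y addnS; exact: xP.
have loja n : 0 < rr n.+1 ->
    rr n.+1 `^ (1 - p^-1) <= c * (enorm (y n.+1 - y n) / lam).
  move=> r0; have yn : y n.+1 = x (m.+1 + n).+1 by rewrite /y addnS.
  have [yC yball] : (Cbar `&` eball xbar delta) (y n.+1).
    by rewrite yn; apply: mloj; rewrite ltnW // ltnS leq_addr.
  have /loj : ((Cbar `&` eball xbar delta) `&` (edom f `\` argmin f)) (y n.+1).
    split=> //; split; first by rewrite /edom /= ltey_eq ffin.
    move=> /(_ xbar); rewrite -(fineK (ffin _ (yfin n.+1))).
    by rewrite -(fineK (ffin _ gxbar)) lee_fin -subr_le0 leNgt r0.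
  rewrite rE poweR_EFin => /le_trans/(_ _).
  rewrite -lee_fin; apply; rewrite EFinM lee_pmul2l //.
  apply: (fb_dist_subdiff gP gC hdiff hconv L0 hlip lam0 lamL).
  by rewrite yn; exact: xP.
have ycvg : y @ \oo --> xbar.
  have -> : y = (fun n => x (n + m.+1)%N) by apply/funext => n; rewrite /y addnC.
  by rewrite (cvg_shiftn m.+1 x).
have dist := iterates_dist p1 c0 lam0 lamL ycvg rr_ge0 drop loja.
have yE := iterates_eq_limit p1 c0 lam0 lamL ycvg rr_ge0 drop loja.
have rec := iterates_recursion c0 lam0 lamL drop loja.
have k0 := kappa_gt0 c0 lam0 lamL.
have rr_le0 n : rr n <= rr 0%N by exact: value_nonincreasing k0 rr_ge0 rec _ _ _.
exists m.+1 => y' r k; rewrite -/k in rec k0.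
have {rE} rE n : r n = (rr n)%:E by exact: rE.
have {}yE n : rr n = 0 -> y' n = xbar by exact: yE.
have {}dist n : enorm (y' n.+1 - xbar) <= energy_bound p c lam L (rr n).
  exact: dist.
(* If the minimum is already reached the sequence is constant, and any
   constants will do. *)
clearbody y' r; have [rr0|] := ltP 0 (rr 0%N); last first.
  move=> rr0; have rr_0 n : rr n = 0.
    by apply/eqP; rewrite eq_le rr_ge0 (le_trans _ rr0).
  have yxbar n : y' n = xbar by exact: yE.
  exists 1, 1; split=> //; first by rewrite rE rr_0 ltxx.
  split=> // [_ n|_ n|_ n]; rewrite !rE !rr_0 yxbar subrr enorm0.
  - by rewrite poweR_ge0 mul1e poweR_ge0.
  - by rewrite mule0 !mule_ge0 ?poweR_ge0 ?lee_fin ?powR_ge0.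
  - by rewrite !mule_ge0 ?epowR_ge0 ?lee_fin ?powR_ge0.
have rr01 n : 0 <= rr n <= rr 0%N by rewrite rr_ge0 rr_le0.
have [Cp' Cp'0 Cp'P] := exists_Cp' p k0 rr0.
have [Cp [Cp0 Cp_ge Cp_le]] : exists Cp : R, [/\ 0 < Cp,
    2 <= p -> Cp = Cp_ge2 p c lam L (rr 0%N) &
    p <= 2 -> Cp = Cp_le2 p c lam L (rr 0%N)].
  have [p2|p2] := leP p 2; last first.
    by exists (Cp_ge2 p c lam L (rr 0%N)); split=> //; exact: Cp_ge2_gt0.
  exists (Cp_le2 p c lam L (rr 0%N)); split=> //; first exact: Cp_le2_gt0.
  move=> p_ge2; have -> : p = 2 by apply/eqP; rewrite eq_le p2.
  exact: Cp_le2_ge2.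
have dist_le2 n : p <= 2 -> enorm (y' n.+1 - xbar) <= Cp * rr n `^ 2^-1.
  move=> p2; rewrite (Cp_le p2); apply: le_trans (dist n) _.
  exact: energy_bound_le2.
have dist_ge2 n : 2 <= p -> enorm (y' n.+1 - xbar) <= Cp * rr n `^ p^-1.
  move=> p2; rewrite (Cp_ge p2); apply: le_trans (dist n) _.
  exact: energy_bound_ge2.
exists Cp, Cp'; split=> //; first by rewrite rE.
split.
- move=> p_1 n; rewrite rE -EFinM lee_fin => rn.
  by apply: yE; apply: (finite_rate k0 rr_ge0 rec).
- move=> /andP[p_gt1 p_lt2] n; rewrite !rE -EFinM !poweR_EFin -EFinM !lee_fin.
  split; first exact: (superlinear_rate k0 rr_ge0 rec).
  exact: dist_le2 (ltW p_lt2).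
- move=> p_2 n; rewrite !rE poweR_EFin -!EFinM !lee_fin; split.
    exact: (linear_step k0 rr_ge0 rec).
  have p2 : p <= 2 by rewrite p_2.
  apply: le_trans (dist_le2 n p2) _; rewrite -mulrA ler_pM2l //.
  have -> : - (n%:R / 2) = - n%:R * 2^-1 :> R by rewrite mulNr.
  rewrite powRrM -powRM ?powR_ge0 //.
  apply: ge0_ler_powR; rewrite ?nnegrE ?mulr_ge0 ?powR_ge0 //.
  exact: (linear_rate k0 rr_ge0 rec).
move=> p2 n; have p20 : 0 < p - 2 by rewrite subr_gt0.
have p0 : 0 < p by exact: lt_le_trans p1.
have e0 : 0 < p / (p - 2) by rewrite divr_gt0.
have e1 : 0 < (p - 2)^-1 by rewrite invr_gt0.
rewrite rE /epowR !oppr_lt0 e0 e1 !andbT pnatr_eq0.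
case: (posnP n) => [_|n0].
  rewrite gt0_muley ?lte_fin ?powR_gt0 // leey.
  by rewrite gt0_muley ?leey // -EFinM lte_fin mulr_gt0 ?powR_gt0.
rewrite -!EFinM !lee_fin.
have rn := sublinear_rate k0 rr_ge0 rec p2 Cp'0 (Cp'P p2) n0.
split=> //; apply: le_trans (dist_ge2 n (ltW p2)) _; rewrite -mulrA ler_pM2l //.
have eE : (p - 2)^-1 = p / (p - 2) * p^-1 by field; rewrite !gt_eqF.
rewrite eE -mulNr !(powRrM _ _ p^-1) -powRM ?powR_ge0 //.
by apply: ge0_ler_powR; rewrite ?nnegrE ?invr_ge0 ?mulr_ge0 ?powR_ge0 ?(ltW p0).
Unshelve. all: by end_near. Qed.
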